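(* Let $k\ge1$, let $\mathbf n=(n_1,\dots,n_k)$ be a tuple of nonnegative integers, $\mathbf d=(d_1,\dots,d_k)$ a tuple of positive integers, and let $\mathcal V_{\mathbf d,\mathbf n}\subset\mathbb P(S^{\mathbf d}V)$ be the Segre-Veronese variety. Let $Q_F$ be a Frobenius inner product on $S^{\mathbf d}V^{\mathbb R}$. Then every inner product $Q$ on $S^{\mathbf d}V^{\mathbb R}$ in a sufficiently small neighborhood of $Q_F$ satisfies $$\mathrm{EDdegree}_Q(\mathcal V_{\mathbf d,\mathbf n})\ge\mathrm{EDdegree}_{Q_F}(\mathcal V_{\mathbf d,\mathbf n}).$$ In other words, any Frobenius inner product is a local minimum of the map $Q\mapsto\mathrm{EDdegree}_Q(\mathcal V_{\mathbf d,\mathbf n})$.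
   Context: Let $V_i^{\mathbb R}$ be real vector spaces with $\dim V_i^{\mathbb R}=n_i+1$, $V_i=V_i^{\mathbb R}\otimes\mathbb C$, $S^{\mathbf d}V=S^{d_1}V_1\otimes\cdots\otimes S^{d_k}V_k$ and $S^{\mathbf d}V^{\mathbb R}=S^{d_1}V_1^{\mathbb R}\otimes\cdots\otimes S^{d_k}V_k^{\mathbb R}$. $\mathcal V_{\mathbf d,\mathbf n}$ is the image of $\mathbb P(V_1)\times\cdots\times\mathbb P(V_k)\to\mathbb P(S^{\mathbf d}V)$, $(x_1,\dots,x_k)\mapsto x_1^{d_1}\otimes\cdots\otimes x_k^{d_k}$. Inner product means positive definite symmetric bilinear form; the set of inner products carries the topology induced from the finite-dimensional vector space of symmetric bilinear forms. A Frobenius inner product on $S^{\mathbf d}V^{\mathbb R}$ is obtained from inner products $Q_i$ on $V_i^{\mathbb R}$ by $Q_F(x_1^{d_1}\otimes\cdots\otimes x_k^{d_k},\,y_1^{d_1}\otimes\cdots\otimes y_k^{d_k})=\prod_{i=1}^kQ_i(x_i,y_i)^{d_i}$, extended by linearity. ED degree: let $W$ be a complex vector space with real structure $W^{\mathbb R}$, $Q$ an inner product on $W^{\mathbb R}$ extended complex bilinearly to $W$, $q(x)=Q(x,x)$, and $X\subset\mathbb P(W)$ a projective variety with affine cone $CX$. Then $\mathrm{EDdegree}_Q(X)$ is the number, for a general $u\in W$, of points $x\in(CX)_{\mathrm{sm}}$ (smooth complex points) such that $Q(u-x,v)=0$ for all $v\in T_xCX$, i.e. of complex critical points of $x\mapsto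 q(u-x)$. *)

(* Defs.v *)
From HB Require Import structures.
From mathcomp Require Import all_boot all_order all_algebra.
From mathcomp Require Import complex mpoly.
From mathcomp Require Import boolp classical_sets functions cardinality.
From mathcomp Require Import reals topology normedtype.
Set Implicit Arguments.
Unset Strict Implicit.
Unset Printing Implicit Defensive.
Import Order.TTheory GRing.Theory Num.Theory.
Import numFieldNormedType.Exports.
Local Open Scope classical_set_scope.
Local Open Scope card_scope.
Local Open Scope ring_scope.

(* Bilinear forms on K^N are given by their Gram matrices in the standard     *)
(* basis.  For K := R[i] and the Gram matrix map_mx (real_complex R) Q, this  *)
(* is the complex bilinear (not sesquilinear) extension of the real form Q.   *)
Definition bform (K : pzSemiRingType) N (Q : 'M[K]_N) (u v : 'rV[K]_N) : K :=
  (u *m Q *m v^T) 0 0.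

Definition inner_product (R : realType) N (Q : 'M[R]_N) : Prop :=
  Q^T = Q /\ forall v : 'rV[R]_N, v != 0 -> 0 < bform Q v v.

Section AffineVarieties.
Variables (K : fieldType) (N : nat).
Implicit Types (X : set 'rV[K]_N) (x v : 'rV[K]_N) (f g : {mpoly K[N]}).

Definition peval f x : K := f.@[fun i => x 0 i].

(* "P holds for a general u": P holds on a nonempty Zariski open set *)
Definition general (P : set 'rV[K]_N) : Prop :=
  exists2 g, g != 0 & forall u, peval g u != 0 -> P u.

Definition vanishing_ideal X : set {mpoly K[N]} :=
  [set f | forall x, X x -> peval f x = 0].

Definition tangent_space X x : set 'rV[K]_N :=
  [set v : 'rV[K]_N | forall f, vanishing_ideal X f ->
             \sum_(i < N) peval (mderiv i f) x * v 0 i = 0].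

(* algebraic independence of the restrictions of the f_i in the coordinate    *)
(* ring K[X] = {mpoly K[N]} / vanishing_ideal X                               *)
Definition alg_independent X m (f : 'I_m -> {mpoly K[N]}) : Prop :=
  forall P : {mpoly K[m]},
    (forall x, X x -> P.@[fun i => peval (f i) x] = 0) -> P = 0.

(* For X irreducible: dim X = m, the transcendence degree of K(X), equivalently *)
(* of K[X], over K.                                                           *)
Definition has_dim X m : Prop :=
  (exists f : 'I_m -> {mpoly K[N]}, alg_independent X f) /\
  (forall f : 'I_m.+1 -> {mpoly K[N]}, ~ alg_independent X f).

(* the smooth points of the irreducible affine variety X: dim T_x X = dim X *)
Definition smooth_locus X : set 'rV[K]_N :=
  [set x | X x /\ exists T : {vspace 'rV[K]_N},
     (forall v, v \in T <-> tangent_space X x v) /\ has_dim X (\dim T)].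

(* A subset X of the projective space P(K^N) is represented by the set of all *)
(* (nonzero) homogeneous coordinate vectors of its points.                    *)
Definition affine_cone X : set 'rV[K]_N := [set x | x = 0 \/ X x].

End AffineVarieties.

Section EDdegree.
Variables (R : realType) (N : nat).
Implicit Types (Q : 'M[R]_N) (X : set 'rV[R[i]]_N).

Definition critical_points Q X (u : 'rV[R[i]]_N) : set 'rV[R[i]]_N :=
  [set x | smooth_locus (affine_cone X) x /\
     forall v, tangent_space (affine_cone X) x v ->
       bform (map_mx (real_complex R) Q) (u - x) v = 0].

(* The number m of critical points for a general u; it is unique if it exists, *)
(* and exists when Q is an inner product and X a projective variety (the value *)
(* 0 of xget is used only if it does not).                                    *)
Definition EDdegree Q X : nat :=
  xget 0%N [set m | general (fun u => critical_points Q X u #= `I_m)].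

End EDdegree.

Definition exponent (m e : nat) : finType :=
  {a : {ffun 'I_m.+1 -> 'I_e.+1} | (\sum_(j < m.+1) (a j : nat) == e)%N}.

Definition multiexponent k (n d : 'I_k -> nat) : finType :=
  {dffun forall i : 'I_k, exponent (n i) (d i)}.

(* dimension of S^d V = S^{d_1} V_1 (x) ... (x) S^{d_k} V_k, V_i = K^(n_i + 1) *)
Definition dimSd k (n d : 'I_k -> nat) : nat := #|{: multiexponent n d}|.

(* V_i = K^(n_i + 1), with K = R or R[i].  An element of S^d V is a tensor that *)
(* is symmetric in the d_i factors V_i, for each i, so that its entry at a     *)
(* position depends only on how many times, a_ij, each basis vector e_j of V_i *)
(* occurs there.  S^d V is identified with K^(dimSd n d) by taking as coordinates *)
(* the entries indexed by the multiexponents a.  Those of the tensor           *)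
(* x_1^{d_1} (x) ... (x) x_k^{d_k} are the monomials \prod_(i,j) x_ij^{a_ij}.  *)
Definition power_tensor (K : comPzRingType) k (n d : 'I_k -> nat)
    (x : forall i : 'I_k, 'rV[K]_(n i).+1) : 'rV[K]_(dimSd n d) :=
  \row_(l < dimSd n d) \prod_(i < k) \prod_(j < (n i).+1)
     x i 0 j ^+ val (enum_val l i) j.

Arguments power_tensor {K k} n d x.

(* homogeneous coordinate vectors of the points of V_{d,n} in P(S^d V) *)
Definition segre_veronese (R : realType) k (n d : 'I_k -> nat) :
    set 'rV[R[i]]_(dimSd n d) :=
  [set w | exists (c : R[i]) (x : forall i : 'I_k, 'rV[R[i]]_(n i).+1),
     [/\ c != 0, forall i, x i != 0 & w = c *: power_tensor n d x]].

(* The tensors x_1^{d_1} (x) ... (x) x_k^{d_k} span S^d V^R, so the Q_i and    *)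
(* the formula determine QF.                                                  *)
Definition Frobenius_inner_product (R : realType) k (n d : 'I_k -> nat)
    (QF : 'M[R]_(dimSd n d)) : Prop :=
  inner_product QF /\
  exists Q : forall i : 'I_k, 'M[R]_((n i).+1),
    (forall i, inner_product (Q i)) /\
    forall x y : forall i : 'I_k, 'rV[R]_(n i).+1,
      bform QF (power_tensor n d x) (power_tensor n d y) =
      \prod_(i < k) bform (Q i) (x i) (y i) ^+ d i.

Arguments segre_veronese R {k} n d.
Arguments Frobenius_inner_product {R k} n d QF.

(* Main.v *)
Require Import Defs.
From HB Require Import structures.
From mathcomp Require Import all_boot all_order all_algebra.
From mathcomp Require Import complex mpoly closed_field finmap.
From mathcomp Require Import boolp classical_sets functions cardinality.
From mathcomp Require Import reals topology normedtype derive.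
From mathcomp Require Import ring zify.
Set Implicit Arguments.
Unset Strict Implicit.
Unset Printing Implicit Defensive.
Import Order.TTheory GRing.Theory Num.Theory.
Import numFieldNormedType.Exports.
Local Open Scope classical_set_scope.
Local Open Scope card_scope.
Local Open Scope ring_scope.

(** The number of critical points is lower semicontinuous in the inner product,
    because nondegenerate solutions of a polynomial system survive small
    perturbations of its coefficients. Let [m] be the ED degree for [QF] and let
    [u] be general, so that there are [m] critical points and all of them are
    nondegenerate. Each of them survives nearby when [(QF, u)] is perturbed
    ([zero_persists]), and distinct ones stay distinct; so all pairs near
    [(QF, u)] have at least [m] critical points ([at_least_persists]). For [Q]
    near [QF] there are data near [u] that are general for [Q], since nonempty
    Zariski open sets are dense ([general_dense]), whence
    [EDdegree_lower_semicontinuous].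

    Three algebraic facts support this argument.

    - Critical points are the fibres of polynomial self-maps of affine space.
      Where one coordinate, the pole, is not zero, the affine cone over the
      Segre-Veronese variety is parametrised by monomials ([sv_chart]). A
      covector conormal to the cone at such a point is determined by its
      coordinates outside the chart, and these together with the coordinates of
      the chart number exactly [N]. So the critical points for [u] in this chart
      correspond to the solutions in K^N, with nonzero pole coordinate, of
      [ed_map Q z = u Q] ([ed_map_normal], [normal_ed_map]).

    - The general fibre of a polynomial self-map [F] of K^n is finite of bounded
      size, and consists of points where the Jacobian matrix is invertible
      ([generic_fibre_bounded], [generic_jacobian]). Indeed [z_j] and the
      components of [F] are n + 1 polynomials in n variables, hence satisfy a
      relation [P_j (z_j, F z) = 0]. If its degree is minimal, the derivative of
      [P_j] in its first variable does not vanish over a general [u]; so [z_j] is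
      one of the finitely many roots of [P_j (-, u)], and differentiating the
      relation inverts the Jacobian matrix.

    - The number of critical points is the same for all general data
      ([general_critical_count]). To have at least [m] critical points is a
      first-order property of [u]. By quantifier elimination it is a boolean
      combination of polynomial equations, so it holds for general [u] or fails
      for general [u] ([definable_decided]); as the numbers of critical points
      are bounded, the largest [m] for which it holds exists.

    Persistence itself is proved by minimising the squared norm of the
    residue of the system over a small compact box: the minimum is attained in
    the interior, and is zero because otherwise a small step in Newton's direction
    would decrease it. *)

(** * Polynomials in several variables *)

Lemma mpoly_ring_ind n (R : comNzRingType) (P : {mpoly R[n]} -> Prop) :
  (forall c, P c%:MP) -> (forall i, P 'X_i) ->
  (forall f g, P f -> P g -> P (f + g)) ->
  (forall f g, P f -> P g -> P (f * g)) -> forall f, P f.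
Proof.
move=> PC PX PD PM f; rewrite (mpolyE f).
have P0 : P 0 by rewrite -mpolyC0; exact: PC.
have P1 : P 1 by rewrite -mpolyC1; exact: PC.
apply: (big_ind P) => // m _; rewrite -mul_mpolyC; apply: (PM _ _) => //.
rewrite mpolyXE_id; apply: (big_ind P) => // i _.
by elim: (m i) => [|k IH]; rewrite ?expr0 // exprS; apply: (PM _ _).
Qed.

(** Both sides are derivations along the ring morphism [mmap c h] that vanish on
    constants. This serves for [deriv] on univariate polynomials, where [h] is a
    polynomial curve, and for the partial derivatives of composed polynomials. *)
Lemma chain_rule n (R A : comNzRingType) (c : {rmorphism R -> A})
    (h : 'I_n -> A) (D : A -> A) :
  {morph D : x y / x + y} -> (forall x y, D (x * y) = D x * y + x * D y) ->
  (forall a, D (c a) = 0) ->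
  forall f : {mpoly R[n]},
    D (mmap c h f) = \sum_(i < n) mmap c h f^`M(i) * D (h i).
Proof.
move=> DD DM DC; elim/mpoly_ring_ind => [a|i|f g IHf IHg|f g IHf IHg].
- by rewrite mmapC DC big1 // => i _; rewrite mderivC mmap0 mul0r.
- rewrite mmapX mmap1U (bigD1 i) //= mderivX mnm1E eqxx scale1r.
  rewrite -[X in 'X_[X - _]]addm0 addmC addmK mpolyX0 rmorph1 mul1r big1 ?addr0 //.
  move=> j ji; rewrite mderivX mnm1E eq_sym (negPf ji) scale0r.
  by rewrite mmap0 mul0r.
- by rewrite mmapD DD IHf IHg -big_split /=; apply: eq_bigr => i _;
    rewrite mderivD mmapD mulrDl.
- rewrite rmorphM DM IHf IHg mulr_suml mulr_sumr -big_split /=.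
  apply: eq_bigr => i _; rewrite mderivM mmapD !rmorphM mulrDl.
  by rewrite mulrAC !mulrA.
Qed.

(** ** Restriction of polynomials to polynomial curves *)

Section Curves.
Variables (K : numFieldType) (n : nat).
Implicit Types (f : {mpoly K[n]}) (x v : 'I_n -> K) (h : 'I_n -> {poly K}).

Definition along h f : {poly K} := mmap (@polyC K) h f.

Lemma horner_along h f t : (along h f).[t] = f.@[fun i => (h i).[t]].
Proof.
rewrite /along; elim/mpoly_ring_ind: f => [a|i|f g|f g].
- by rewrite mmapC mevalC hornerC.
- by rewrite mmapX mmap1U mevalXU.
- by rewrite mmapD hornerD mevalD => -> ->.
- by rewrite rmorphM hornerM mevalM => -> ->.
Qed.

Lemma deriv_along h f :
  (along h f)^`() = \sum_(i < n) along h f^`M(i) * (h i)^`().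
Proof.
apply: (@chain_rule _ _ _ (@polyC K) h (@deriv K)) => [p q|p q|a].
- exact: derivD.
- exact: derivM.
- exact: derivC.
Qed.

Definition line x v (i : 'I_n) : {poly K} := (x i)%:P + v i *: 'X.

Lemma horner_line x v i t : (line x v i).[t] = x i + t * v i.
Proof. by rewrite /line !hornerE mulrC. Qed.

Lemma along_lineE x v f t : (along (line x v) f).[t] = f.@[fun i => x i + t * v i].
Proof. by rewrite horner_along; apply: meval_eq => i; rewrite horner_line. Qed.

Lemma deriv_line x v i : (line x v i)^`() = (v i)%:P.
Proof. by rewrite /line derivD derivC derivZ derivX add0r alg_polyC. Qed.

Lemma poly_eq0_horner (p : {poly K}) : (forall t, p.[t] = 0) -> p = 0.
Proof.
move=> p0; apply/eqP; apply: contraT => pN0.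
have := @max_poly_roots _ p [seq (i%:R : K) | i <- iota 0 (size p)] pN0.
rewrite size_map size_iota ltnn => /(_ _ _)-> //.
  by apply/allP => _ /mapP[i _ ->]; rewrite /root p0.
rewrite map_inj_uniq ?iota_uniq // => i j /eqP.
by rewrite eqr_nat => /eqP.
Qed.

Lemma poly_eq0_cofinite (p q : {poly K}) :
  q != 0 -> (forall t, q.[t] != 0 -> p.[t] = 0) -> p = 0.
Proof.
move=> qN0 pq; apply/eqP; have : p * q == 0.
  apply/eqP/poly_eq0_horner => t; rewrite hornerM.
  by have [->|/pq->] := eqVneq q.[t] 0; rewrite ?mulr0 ?mul0r.
by rewrite mulf_eq0 (negPf qN0) orbF.
Qed.

Lemma poly_deriv_eq0 (p : {poly K}) : p^`() = 0 -> forall s t, p.[s] = p.[t].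
Proof.
move=> p'0 s t; suff -> : p = (p`_0)%:P by rewrite !hornerC.
apply/polyP => -[|i]; rewrite coefC //=.
have /polyP/(_ i) := p'0; rewrite coef_deriv coef0 => /eqP.
by rewrite mulrn_eq0 => /eqP.
Qed.

Lemma mderiv_eq0_meval f x y :
  (forall i, x i != y i -> f^`M(i) = 0) -> f.@[x] = f.@[y].
Proof.
move=> fxy; have := @poly_deriv_eq0 (along (line x (fun i => y i - x i)) f) _ 0 1.
rewrite !along_lineE => E.
rewrite (meval_eq (v2 := fun i => x i + 0 * (y i - x i))); last first.
  by move=> i; rewrite mul0r addr0.
rewrite E; first by apply: meval_eq => i; rewrite mul1r addrC subrK.
rewrite deriv_along big1 // => i _; rewrite deriv_line.
have [->|/fxy->] := eqVneq (x i) (y i); first by rewrite subrr mulr0.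
by rewrite /along mmap0 mul0r.
Qed.

Lemma mpoly_mderiv_eq0 f : (forall i, f^`M(i) = 0) -> f = (f@_0)%:MP.
Proof.
move=> f'0; apply/mpolyP => m; rewrite mcoeffC eq_sym.
have [->|mN0] := eqVneq m 0%MM; first by rewrite mulr1.
have [i mi] : exists i, m i != 0%N.
  apply/existsP; rewrite -negb_forall; apply: contra mN0 => /forallP m0.
  by apply/eqP/mnmP => i; rewrite mnm0E (eqP (m0 i)).
have /mpolyP/(_ (m - U_(i))%MM) := f'0 i.
rewrite mcoeff_mderiv mcoeff0 submK ?lep1mP // => /eqP.
by rewrite mulrn_eq0 /= mulr0 => /eqP.
Qed.

Lemma msize_mderiv f i : f != 0 -> (msize f^`M(i) < msize f)%N.
Proof.
rewrite -msize_poly_eq0 -lt0n => sf; rewrite msizeE -(prednK sf) ltnS.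
apply/bigmax_leqP_seq => m; rewrite mcoeff_msupp mcoeff_mderiv => cm _.
have : (m + U_(i))%MM \in msupp f.
  by rewrite mcoeff_msupp; apply: contra cm => /eqP->; rewrite mul0rn.
by move/msize_mdeg_lt; rewrite mdegD mdeg1 addn1 -{1}(prednK sf) ltnS.
Qed.

(** By induction on the degree: if [f] vanishes everywhere then it does so along
    the coordinate lines, hence its partial derivatives vanish everywhere too and
    are zero by induction, so that [f] is constant. *)
Lemma mpoly_eq0_meval f : (forall x, f.@[x] = 0) -> f = 0.
Proof.
have [k] := ubnP (msize f); elim: k f => // k IH f; rewrite ltnS => sf f0.
have [->//|fN0] := eqVneq f 0.
suff f'0 i : f^`M(i) = 0.
  by have := f0 (fun=> 0); rewrite (mpoly_mderiv_eq0 f'0) mevalC => ->.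
apply: IH => [|x]; first exact: leq_trans (msize_mderiv i fN0) sf.
pose e (j : 'I_n) : K := (j == i)%:R.
have : (along (line x e) f)^`() = 0.
  by rewrite (@poly_eq0_horner (along (line x e) f)) ?deriv0 // => t; rewrite along_lineE.
rewrite deriv_along => /(congr1 (horner^~ 0)); rewrite horner_sum hornerC.
rewrite (bigD1 i) //= big1 ?addr0 => [|j ji]; last first.
  by rewrite deriv_line /e (negPf ji) mulr0 horner0.
rewrite deriv_line /e eqxx mulr1 along_lineE => <-.
by apply: meval_eq => j; rewrite mul0r addr0.
Qed.

Lemma mpoly_neq0_meval f : f != 0 -> exists x, f.@[x] != 0.
Proof.
move=> fN0; apply: contrapT => /forallNP nx; case/negP: fN0.
by apply/eqP/mpoly_eq0_meval => x; apply/eqP/negPn/negP => /nx.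
Qed.

(** The bound does not depend on the line: this makes the sizes of the general
    fibres uniformly bounded. *)
Lemma size_along_line_bounded f :
  exists e, forall x v, (size (along (line x v) f) <= e)%N.
Proof.
rewrite /along; elim/mpoly_ring_ind: f => [c|i|f g [e fe] [e' ge]|f g [e fe] [e' ge]].
- by exists 1%N => x v; rewrite mmapC size_polyC leq_b1.
- exists 2%N => x v; rewrite mmapX mmap1U /line.
  rewrite (leq_trans (size_polyD _ _)) // geq_max size_polyC.
  rewrite (leq_trans (leq_b1 _)) //= (leq_trans (size_scale_leq _ _)) //.
  by rewrite size_polyX.
- exists (maxn e e') => x v; rewrite mmapD (leq_trans (size_polyD _ _)) //.
  by rewrite geq_max !leq_max fe ge /= orbT.
- exists (e + e')%N => x v; rewrite rmorphM (leq_trans (size_polyMleq _ _)) //.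
  by apply: leq_trans (leq_pred _) _; apply: leq_add; [exact: fe|exact: ge].
Qed.

End Curves.

(** * Algebraic dependence *)

Section AlgebraicDependence.
Variables (K : fieldType).

Lemma msizeM_leq n (p q : {mpoly K[n]}) :
  (msize (p * q) <= msize p + msize q)%N.
Proof.
have [->|pN0] := eqVneq p 0; first by rewrite mul0r msize0.
have [->|qN0] := eqVneq q 0; first by rewrite mulr0 msize0.
by rewrite msizeM // leq_pred.
Qed.

Lemma msize_exp_leq n (p : {mpoly K[n]}) a e :
  (msize p <= e)%N -> (msize (p ^+ a) <= a * e + 1)%N.
Proof.
move=> pe; elim: a => [|a IH]; first by rewrite expr0 msize1.
rewrite exprS mulSn -addnA (leq_trans (msizeM_leq _ _)) // leq_add //.
Qed.

Lemma msize_prod_leq n (I : finType) (p : I -> {mpoly K[n]}) e :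
  (forall i, msize (p i) <= e)%N -> (msize (\prod_i p i) <= #|I| * e + 1)%N.
Proof.
move=> pe; rewrite cardT enumT [index_enum I]unlock.
elim: (Finite.enum I) => [|i s IH].
  by rewrite big_nil msize1.
rewrite big_cons /= mulSn -addnA (leq_trans (msizeM_leq _ _)) // leq_add //.
Qed.

(** Counting dimensions: there are [D.+1 ^ n.+1] monomials in the [f i] with
    exponents at most [D], and they lie in a space of polynomials whose dimension
    is only of the order of [D ^ n]. *)
Lemma algebraic_dependence n (f : 'I_n.+1 -> {mpoly K[n]}) :
  exists2 P : {mpoly K[n.+1]}, P != 0 & mmap (@mpolyC n K) f P = 0.
Proof.
pose e := (\max_i msize (f i))%N.
have fe i : (msize (f i) <= e)%N by exact: leq_bigmax.
(* With E.+1 <= c * D.+1 the count needs c ^ n < D.+1. *)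
pose c := (n.+1 * e + n.+2)%N; pose D := (c ^ n)%N.
pose E := (n.+1 * (D * e + 1) + 1)%N.
pose A := {ffun 'I_n.+1 -> 'I_D.+1}; pose B := {ffun 'I_n -> 'I_E.+1}.
pose ma (a : A) := [multinom (a i : nat) | i < n.+1].
pose mb (b : B) := [multinom (b i : nat) | i < n].
pose F (a : A) := \prod_(i < n.+1) f i ^+ a i.
have sF a : (msize (F a) <= E)%N.
  rewrite /E -{1}[n.+1]card_ord; apply: msize_prod_leq => i.
  apply: leq_trans (msize_exp_leq _ (fe i)) _.
  by rewrite leq_add2r leq_mul2r -ltnS ltn_ord orbT.
pose M := \matrix_(i < #|A|, j < #|B|) (F (enum_val i))@_(mb (enum_val j)).
have cardBA : (#|B| < #|A|)%N.
  rewrite !card_ffun !card_ord expnS.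
  have D_gt0 : (0 < D)%N by rewrite expn_gt0 /c; lia.
  apply: (@leq_ltn_trans ((c * D.+1) ^ n)).
    have [->|n_gt0] := posnP n; first by rewrite !expn0.
    by rewrite leq_exp2r // /E /c; nia.
  by rewrite expnMn -/D ltn_pmul2r ?expn_gt0.
have : kermx M != 0.
  rewrite -mxrank_eq0 mxrank_ker subn_eq0 -ltnNge.
  exact: leq_ltn_trans (rank_leq_col M) cardBA.
case/rowV0Pn => v /sub_kermxP vM vN0.
exists (\sum_i v 0 i *: 'X_[ma (enum_val i)]).
  have [i vi] : exists i, v 0 i != 0 by apply/rV0Pn.
  apply: contra vi => /eqP/mpolyP/(_ (ma (enum_val i))).
  rewrite raddf_sum /= mcoeff0 (bigD1 i) //= big1 => [|j ji].
    by rewrite mcoeffZ mcoeffX eqxx mulr1 addr0 => ->.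
  rewrite mcoeffZ mcoeffX; case: eqP => [E1|]; rewrite ?mulr0 //.
  case/negP: ji; apply/eqP/enum_val_inj/ffunP => k; apply/val_inj.
  by have := congr1 (fun m : 'X_{1.. n.+1} => m k) E1; rewrite !mnmE.
rewrite raddf_sum; apply/mpolyP => m; rewrite raddf_sum /= mcoeff0.
under eq_bigr => i _ do rewrite mmapZ mmapX mul_mpolyC mcoeffZ.
(* Monomials outside the box do not occur in any of the products [F a]. *)
have [mE|mE] := boolP [forall i, (m i < E.+1)%N]; last first.
  rewrite big1 // => i _; rewrite memN_msupp_eq0 ?mulr0 //.
  apply/msize_mdeg_ge/(leq_trans _ (_ : E <= mdeg m)%N).
    rewrite (leq_trans _ (sF (enum_val i))) //; apply/eq_leq; congr (msize _).
    by apply: eq_bigr => j _; rewrite mnmE.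
  move: mE; rewrite negb_forall => /existsP[j mj].
  rewrite -leqNgt in mj; rewrite mdegE (bigD1 j) //=.
  by rewrite (leq_trans (ltnW mj)) // leq_addr.
pose b : B := [ffun i => inord (m i)].
have mbE : mb b = m.
  apply/mnmP => k; rewrite mnmE ffunE inordK //; exact: (forallP mE).
have := congr1 (fun N : 'M_(_, _) => N 0 (enum_rank b)) vM.
rewrite /= mxE [RHS]mxE => E0; rewrite -[RHS]E0; apply: eq_bigr => i _.
rewrite mxE enum_rankK mbE; congr (_ * _@__).
by apply: eq_bigr => j _; rewrite mnmE.
Qed.

Local Notation subst f P := (mmap (@mpolyC _ K) f P).

Lemma meval_subst m n (f : 'I_m -> {mpoly K[n]}) P x :
  (subst f P).@[x] = P.@[fun i => (f i).@[x]].
Proof.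
elim/mpoly_ring_ind: P => [a|i|p q|p q].
- by rewrite mmapC !mevalC.
- by rewrite mmapX mmap1U mevalXU.
- by rewrite mmapD !mevalD => -> ->.
- by rewrite rmorphM !mevalM => -> ->.
Qed.

Lemma minimal_annihilator n (f : 'I_n.+1 -> {mpoly K[n]}) :
  exists P : {mpoly K[n.+1]}, [/\ P != 0, subst f P = 0 &
    forall Q, (msize Q < msize P)%N -> subst f Q = 0 -> Q = 0].
Proof.
have [P PN0 fP] := algebraic_dependence f.
have [k] := ubnP (msize P); elim: k P PN0 fP => // k IH P PN0 fP.
rewrite ltnS => sP.
have [[Q [sQ fQ QN0]]|nQ] := pselect (exists Q,
  [/\ (msize Q < msize P)%N, subst f Q = 0 & Q != 0]).
  by apply: IH QN0 fQ _; apply: leq_trans sQ sP.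
exists P; split=> // Q sQ fQ; apply/eqP; apply: contrapT => /negP QN0.
by apply: nQ; exists Q.
Qed.

End AlgebraicDependence.

(** * Generic fibres of a polynomial self-map *)

Section GenericFibre.
Variables (K : numFieldType) (n : nat).
Implicit Types (F : 'I_n -> {mpoly K[n]}).
Local Notation subst f P := (mmap (@mpolyC _ K) f P).

Definition fcons T (x : T) (f : 'I_n -> T) (i : 'I_n.+1) : T :=
  oapp f x (unlift ord0 i).

Lemma fcons0 T (x : T) f : fcons x f ord0 = x.
Proof. by rewrite /fcons unlift_none. Qed.

Lemma fconsS T (x : T) f i : fcons x f (lift ord0 i) = f i.
Proof. by rewrite /fcons liftK. Qed.

Lemma fcons_comp T T' (g : T -> T') (x : T) f i :
  g (fcons x f i) = fcons (g x) (g \o f) i.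
Proof. by rewrite /fcons; case: unliftP. Qed.

Lemma meval_subst_fcons (P : {mpoly K[n.+1]}) h F z :
  (subst (fcons h F) P).@[z] = P.@[fcons h.@[z] (fun i => (F i).@[z])].
Proof.
rewrite meval_subst; apply: meval_eq => i.
by rewrite (fcons_comp (meval z)).
Qed.

Definition at0 (P : {mpoly K[n.+1]}) : {mpoly K[n]} :=
  subst (fcons 0 (fun i => 'X_i)) P.

Lemma meval_at0 P u : (at0 P).@[u] = P.@[fcons 0 u].
Proof.
rewrite meval_subst_fcons; apply: meval_eq => i.
by rewrite /fcons; case: unliftP => [j _|_] /=; rewrite ?mevalXU ?meval0.
Qed.

Lemma mpoly_at0 (P : {mpoly K[n.+1]}) :
  exists Q, P = subst (fun i => 'X_(lift ord0 i)) (at0 P) + 'X_ord0 * Q.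
Proof.
rewrite /at0; elim/mpoly_ring_ind: P => [c|i|p q [Q {1}->] [Q' {1}->]|p q].
- by exists 0; rewrite !mmapC mulr0 addr0.
- rewrite mmapX mmap1U; case: (unliftP ord0 i) => [j ->|->].
    by exists 0; rewrite fconsS mmapX mmap1U mulr0 addr0.
  by exists 1; rewrite fcons0 mmap0 mulr1 add0r.
- by exists (Q + Q'); rewrite !mmapD mulrDr addrACA.
- case=> Q; set p0 := mmap _ _ _ => ep [Q']; set q0 := mmap _ _ _ => eq.
  exists (Q * q0 + p0 * Q' + 'X_ord0 * (Q * Q')).
  rewrite 2!rmorphM -/p0 -/q0 {1}ep {1}eq.
  ring.
Qed.

(** A relation [P (h, F) = 0] of minimal degree is not divisible by its first
    variable, so that [P (0, -)] is not zero; it vanishes at [F z] if [h z = 0]. *)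
Lemma image_of_hypersurface F (h : {mpoly K[n]}) : h != 0 ->
  exists2 g : {mpoly K[n]}, g != 0 &
    forall z, h.@[z] = 0 -> g.@[fun i => (F i).@[z]] = 0.
Proof.
move=> hN0; have [P [PN0 hP minP]] := minimal_annihilator (fcons h F).
exists (at0 P) => [|z hz]; last first.
  by rewrite meval_at0 -hz -meval_subst_fcons hP meval0.
apply: contraNneq PN0 => P0; have [Q PE] := mpoly_at0 P.
move: PE; rewrite P0 mmap0 add0r; have [->|QN0] := eqVneq Q 0 => PE.
  by rewrite PE mulr0.
rewrite {1}PE (minP Q) ?mulr0 //.
  by rewrite PE msizeM -?msize_poly_eq0 ?msizeX ?mdeg1 // msize_poly_eq0.
move/eqP: hP; rewrite PE rmorphM /= mmapX mmap1U fcons0 mulf_eq0 (negPf hN0).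
by move/eqP.
Qed.

(** Take a relation [P (z_j, F z) = 0] of minimal degree. The derivative of [P] in
    its first variable has smaller degree, so it does not vanish identically on
    the graph, and its zeros there map into a hypersurface. If that derivative is
    the zero polynomial then [P (0, -)] is a nonzero polynomial that vanishes on
    the image of [F], so that the last clause is vacuous. *)
Lemma separable_relation F j :
  exists (P : {mpoly K[n.+1]}) (g : {mpoly K[n]}),
    [/\ subst (fcons 'X_j F) P = 0, g != 0 &
    forall z, g.@[fun i => (F i).@[z]] != 0 ->
      P^`M(ord0).@[fcons (z j) (fun i => (F i).@[z])] != 0].
Proof.
have [P [PN0 jP minP]] := minimal_annihilator (fcons 'X_j F).
exists P; have [P'0|P'N0] := eqVneq P^`M(ord0) 0.
  have PE t u : P.@[fcons t u] = (at0 P).@[u].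
    rewrite meval_at0; apply: mderiv_eq0_meval => i.
    by rewrite /fcons; case: unliftP => [k _|->] /=; rewrite ?eqxx.
  exists (at0 P); split=> // [|z].
    have [x] := mpoly_neq0_meval PN0; apply: contra_neq => P0.
    rewrite (meval_eq (v2 := fcons (x ord0) (fun i => x (lift ord0 i)))).
      by rewrite PE P0 meval0.
    by move=> i; case: (unliftP ord0 i) => [k ->|->]; rewrite ?fconsS ?fcons0.
  by rewrite -(PE ('X_j).@[z]) -meval_subst_fcons jP meval0 eqxx.
have hN0 : subst (fcons 'X_j F) P^`M(ord0) != 0.
  by apply: contra_neq P'N0 => /minP->//; apply: msize_mderiv.
have [g gN0 gP] := image_of_hypersurface F hN0.
exists g; split=> // z; apply: contra_neq => hz; apply: gP.
by rewrite meval_subst_fcons mevalXU.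
Qed.

Definition jacobian F z : 'M[K]_n := \matrix_(i, l) (F i)^`M(l).@[z].

(** Differentiating the relations [P_j (z_j, F z) = 0] exhibits a left inverse
    of the Jacobian matrix, up to the diagonal matrix of the derivatives of the
    [P_j] in their first variable. *)
Lemma generic_jacobian F :
  exists2 g : {mpoly K[n]}, g != 0 &
    forall z, g.@[fun i => (F i).@[z]] != 0 -> \det (jacobian F z) != 0.
Proof.
have /choice[P /choice[g Pg]] := separable_relation F.
exists (\prod_j g j) => [|z].
  by apply/prodf_neq0 => j _; have [] := Pg j.
rewrite rmorph_prod /= => /prodf_neq0 gz.
pose y j := fcons (z j) (fun i => (F i).@[z]).
pose A := \matrix_(j < n, i < n) (P j)^`M(lift ord0 i).@[y j].
pose d : 'rV_n := \row_j - (P j)^`M(ord0).@[y j].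
have AJ : A *m jacobian F z = diag_mx d.
  apply/matrixP => j l; rewrite !mxE; have [jP _ _] := Pg j.
  have := @chain_rule _ _ _ (@mpolyC n K) (fcons 'X_j F) (mderiv l)
    (mderivD l) (mderivM l) (mderivC l) (P j).
  rewrite jP mderiv0 big_ord_recl => /(congr1 (meval z)).
  rewrite meval0 mevalD mevalM !meval_subst_fcons mevalXU -/(y j) fcons0.
  rewrite mderivX mnm1E (raddf_sum (meval z)) mevalZ /=.
  under eq_bigr => i _ do rewrite mevalM meval_subst_fcons mevalXU -/(y j) fconsS.
  have -> : (j == l)%:R * 'X_[U_(j) - U_(l)].@[z] = (j == l)%:R :> K.
    case: eqP => [->|]; rewrite ?mul0r // mul1r.
    by rewrite -[X in (X - _)%MM]add0m addmK mpolyX0 meval1.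
  move/esym/eqP; rewrite addrC addr_eq0 => /eqP E.
  under eq_bigr => i _ do rewrite !mxE.
  by rewrite E; case: eqP => _; rewrite ?mulr1 ?mulr0 ?oppr0.
have : \det (A *m jacobian F z) != 0.
  rewrite AJ det_diag; apply/prodf_neq0 => j _; rewrite mxE oppr_eq0.
  by have [_ _ ->] := Pg j; rewrite ?gz.
by rewrite det_mulmx mulf_eq0 negb_or => /andP[].
Qed.

Lemma uniq_box_leq (e : nat) (s : seq 'rV[K]_n)
    (r : 'I_n -> seq K) : uniq s -> (forall j, size (r j) <= e)%N ->
  (forall z j, z \in s -> z 0 j \in r j) -> (size s <= e.+1 ^ n)%N.
Proof.
move=> us re sr.
pose c (z : 'rV[K]_n) : {ffun 'I_n -> 'I_e.+1} := [ffun j => inord (index (z 0 j) (r j))].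
have ci : {in s &, injective c}.
  move=> z z' sz sz' /ffunP E; apply/rowP => j.
  have := E j; rewrite !ffunE => /(congr1 val) /=.
  have ix y : y \in s -> (index (y 0%R j) (r j) < e.+1)%N.
    by move=> ys; rewrite ltnS (leq_trans (index_size _ _)).
  rewrite !inordK ?ix // => /(congr1 (nth 0 (r j))).
  by rewrite !nth_index ?sr.
have := max_card (mem (map c s)); rewrite (card_uniqP _); last by rewrite map_inj_in_uniq.
by rewrite size_map card_ffun !card_ord.
Qed.

(** The coordinates of the points over [u] are roots of the relations of
    [separable_relation], specialised at [u]; these are nonzero, as their
    derivatives do not vanish at the points of the fibre. *)
Lemma generic_fibre_bounded F :
  exists2 g : {mpoly K[n]}, g != 0 &
    exists e, forall u (s : seq 'rV[K]_n), g.@[u] != 0 -> uniq s ->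
      (forall z, z \in s -> forall i, (F i).@[fun j => z 0 j] = u i) ->
      (size s <= e)%N.
Proof.
have /choice[P /choice[g Pg]] := separable_relation F.
exists (\prod_j g j) => [|]; first by apply/prodf_neq0 => j _; have [] := Pg j.
have /choice[b Pb] j := size_along_line_bounded (P j).
pose e := (\max_j b j)%N; exists (e.+1 ^ n)%N => u s gu us sF.
apply: (@uniq_box_leq e s (fun j => undup [seq z 0 j | z : 'rV[K]_n <- s])) => // [j|z j zs].
  2: by rewrite mem_undup; apply/mapP; exists z.
case: s us sF => [//|z0 s] us sF; set r := undup _.
pose p := along (line (fcons 0 u) (fcons 1 (fun=> 0))) (P j).
have pE t : p.[t] = (P j).@[fcons t u].
  rewrite along_lineE; apply: meval_eq => i.
  by case: (unliftP ord0 i) => [k ->|->];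
    rewrite ?fconsS ?fcons0 ?mulr0 ?mulr1 ?addr0 ?add0r.
have [jP gN0 gP] := Pg j.
have Fz z : z \in z0 :: s -> forall i, (F i).@[fun j => z 0 j] = u i by exact: sF.
have pN0 : p != 0.
  have zz0 : z0 \in z0 :: s by rewrite mem_head.
  apply: contraTneq gu => p0; rewrite rmorph_prod /= negbK.
  apply/prodf_eq0; exists j => //; rewrite -[_ == 0]negbK; apply: contraT.
  rewrite negbK => gu.
  have := gP (z0 0); rewrite (meval_eq (v2 := u)); last exact: Fz.
  move=> /(_ gu); rewrite (meval_eq (v2 := fcons (z0 0 j) u)); last first.
    by move=> i; rewrite /fcons; case: unliftP => //= k _; exact: Fz.
  have := congr1 (fun q => q^`().[z0 0 j]) p0.
  rewrite /= deriv0 horner0 deriv_along horner_sum big_ord_recl big1 ?addr0.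
    rewrite deriv_line fcons0 hornerM hornerC mulr1 along_lineE => E.
    move=> /negP[]; apply/eqP; rewrite -[RHS]E; apply: meval_eq.
    by move=> i; case: (unliftP ord0 i) => [k ->|->];
      rewrite ?fconsS ?fcons0 ?mulr0 ?mulr1 ?addr0 ?add0r.
  by move=> i _; rewrite deriv_line fconsS mulr0 horner0.
have : (size r < size p)%N.
  apply: max_poly_roots => //; last exact: undup_uniq.
  apply/allP => t; rewrite mem_undup => /mapP[z zs ->].
  rewrite /root pE -(eqP (_ : (subst (fcons 'X_j F) (P j)).@[z 0] == 0)).
    rewrite meval_subst_fcons mevalXU; apply/eqP; apply: meval_eq => i.
    by rewrite /fcons; case: unliftP => //= k _; rewrite (Fz z).
  by rewrite jP meval0.
move=> /ltnW/leq_trans; apply; apply: leq_trans (Pb j _ _) _.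
exact: leq_bigmax.
Qed.

End GenericFibre.

(** * Conditions that hold for general points *)

Section General.
Variables (K : numFieldType) (n : nat).
Implicit Types (P Q : set 'rV[K]_n).

Lemma general_sub P Q : P `<=` Q -> general P -> general Q.
Proof. by move=> PQ [g gN0 gP]; exists g => // u /gP/PQ. Qed.

Lemma generalT : general [set: 'rV[K]_n].
Proof. by exists 1 => //; rewrite oner_eq0. Qed.

Lemma generalI P Q : general P -> general Q -> general (P `&` Q).
Proof.
move=> [g gN0 gP] [h hN0 hQ]; exists (g * h); first by rewrite mulf_neq0.
move=> u; rewrite /peval mevalM mulf_eq0 negb_or => /andP[gu hu].
by split; [exact: gP|exact: hQ].
Qed.

Lemma general_forall (I : finType) (P : I -> set 'rV[K]_n) :
  (forall i, general (P i)) -> general [set u | forall i, P i u].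
Proof.
move=> gP; have /choice[g gP'] : forall i, exists g : {mpoly K[n]},
    g != 0 /\ forall u, peval g u != 0 -> P i u.
  by move=> i; have [g] := gP i; exists g.
exists (\prod_i g i); first by apply/prodf_neq0 => i _; have [] := gP' i.
move=> u; rewrite /peval rmorph_prod /= => /prodf_neq0 gu i.
by have [_] := gP' i; apply; apply: gu.
Qed.

Lemma general_nonempty P : general P -> exists u, P u.
Proof.
move=> [g /mpoly_neq0_meval[x gx] gP]; exists (\row_i x i); apply: gP.
by rewrite /peval (meval_eq (v2 := x)) // => i; rewrite mxE.
Qed.

Definition generically_decided P := general P \/ general (~` P).

Lemma decidedC P : generically_decided P -> generically_decided (~` P).
Proof. by case=> ?; [right; rewrite setCK|left]. Qed.

Lemma decidedI P Q : generically_decided P -> generically_decided Q ->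
  generically_decided (P `&` Q).
Proof.
move=> [gP|gP] [gQ|gQ]; first by left; exact: generalI.
- by right; apply: general_sub gQ => u h [].
- by right; apply: general_sub gP => u h [].
- by right; apply: general_sub gP => u h [].
Qed.

Lemma decidedU P Q : generically_decided P -> generically_decided Q ->
  generically_decided (P `|` Q).
Proof.
by move=> dP dQ; rewrite -[_ `|` _]setCK setCU; apply/decidedC/decidedI;
  apply/decidedC.
Qed.

Lemma decided_exists (I : finType) (P : I -> set 'rV[K]_n) :
  (forall i, generically_decided (P i)) ->
  generically_decided [set u | exists i, P i u].
Proof.
move=> dP; have [[i gPi]|nP] := pselect (exists i, general (P i)).
  by left; apply: general_sub gPi => u Pu; exists i.
right; apply: (@general_sub [set u | forall i, (~` P i) u]).
  by move=> u nPu [i /nPu].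
by apply: general_forall => i; have [gP|//] := dP i; case: nP; exists i.
Qed.

Lemma decided_eq (f : {mpoly K[n]}) : generically_decided [set u | peval f u = 0].
Proof.
have [->|fN0] := eqVneq f 0.
  by left; apply: general_sub generalT => u _; rewrite /= /peval meval0.
by right; exists f => // u /eqP.
Qed.

End General.

Section Definable.
Variable K : numClosedFieldType.

(** First-order definability with parameters, in the language of rings; the
    variable of number [i] stands for the coordinate of number [i]. *)
Definition definable n (P : set 'rV[K]_n) :=
  exists f : GRing.formula K, forall e : seq K,
    GRing.holds e f <-> P (\row_(i < n) e`_i).

Section Closure.
Variable n : nat.
Implicit Types (P Q : set 'rV[K]_n).

Lemma definable_iff P Q : (forall u, P u <-> Q u) -> definable P -> definable Q.
Proof. by move=> PQ [f fP]; exists f => e; rewrite fP PQ. Qed.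

Lemma definable_peval (f : {mpoly K[n]}) : definable [set u | peval f u = 0].
Proof.
suff [t tf] : exists t : GRing.term K, forall e,
    GRing.eval e t = peval f (\row_(i < n) e`_i).
  by exists (GRing.Equal t (GRing.Const 0)) => e /=; rewrite tf.
elim/mpoly_ring_ind: f => [c|i|f g [s sf] [t tg]|f g [s sf] [t tg]].
- by exists (GRing.Const c) => e; rewrite /peval mevalC.
- by exists (GRing.Var K i) => e; rewrite /peval mevalXU mxE.
- by exists (GRing.Add s t) => e; rewrite /= sf tg /peval mevalD.
- by exists (GRing.Mul s t) => e; rewrite /= sf tg /peval mevalM.
Qed.

Lemma definableC P : definable P -> definable (~` P).
Proof. by move=> [f fP]; exists (GRing.Not f) => e /=; rewrite fP. Qed.

Lemma definableI P Q : definable P -> definable Q -> definable (P `&` Q).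
Proof. by move=> [f fP] [g gQ]; exists (GRing.And f g) => e /=; rewrite fP gQ. Qed.

Lemma definable_forall (I : finType) (P : I -> set 'rV[K]_n) :
  (forall i, definable (P i)) -> definable [set u | forall i, P i u].
Proof.
move=> /choice[f fP].
exists (foldr (@GRing.And K) (GRing.Bool true) [seq f i | i <- enum I]) => e.
have -> : GRing.holds e (foldr (@GRing.And K) (GRing.Bool true)
    [seq f i | i <- enum I]) <-> (forall i, i \in enum I -> GRing.holds e (f i)).
  elim: (enum I) => [|i s IH] /=; first by split.
  rewrite IH; split=> [[fi fs] j|fs].
    by rewrite inE => /predU1P[->//|/fs].
  by split=> [|j js]; apply: fs; rewrite inE ?eqxx ?js ?orbT.
by split=> fu i => [|_]; apply/fP; apply: fu; rewrite mem_enum.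
Qed.

End Closure.

(** The coordinates of [v] are the quantified variables [n], ..., [n + p - 1]. *)
Lemma definable_proj n p (P : set 'rV[K]_(n + p)) :
  definable P -> definable [set u : 'rV_n | exists v : 'rV_p, P (row_mx u v)].
Proof.
move=> [f fP]; exists (foldr (@GRing.Exists K) f (iota n p)) => e.
rewrite -GRing.foldExistsP; split=> [[e' ee' /fP Pe']|[v Pv]].
  exists (\row_(i < p) e'`_(n + i)); congr P: Pe'.
  apply/rowP => i; rewrite mxE; case: (splitP i) => j ij.
    have -> : i = lshift p j by exact/val_inj.
    by rewrite row_mxEl !mxE ee' // !inE mem_iota /= leqNgt ltn_ord.
  have -> : i = rshift n j by exact/val_inj.
  by rewrite row_mxEr mxE.
pose w i := if insub i is Some j then row_mx (\row_(l < n) e`_l) v 0 j else e`_i.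
have we i : (mkseq w (maxn (size e) (n + p)))`_i = w i.
  have [im|mi] := ltnP i (maxn (size e) (n + p)); first by rewrite nth_mkseq.
  move: (mi); rewrite geq_max => /andP[ei ni].
  by rewrite /w insubN -?leqNgt // !nth_default ?size_mkseq.
exists (mkseq w (maxn (size e) (n + p))); last first.
  by apply/fP; congr P: Pv; apply/rowP => i; rewrite [RHS]mxE we /w valK.
move=> i; rewrite !inE mem_iota we /w; case: insubP => //= j _ <-.
case: (splitP j) => l jl; last by rewrite jl leq_addr ltn_add2l ltn_ord.
by have -> : j = lshift p l by [exact/val_inj]; rewrite row_mxEl mxE.
Qed.

(** Quantifiers over an algebraically closed field can be eliminated, and a
    quantifier-free condition is a boolean combination of polynomial ones. *)
Lemma definable_decided n (P : set 'rV[K]_n) :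
  definable P -> generically_decided P.
Proof.
move=> [f fP].
have closedK : GRing.closed_field_axiom K by exact: GRing.solve_monicpoly.
pose qe := GRing.quantifier_elim (@ClosedFieldQE.ex_elim K) (GRing.to_rform f).
pose env (u : 'rV[K]_n) := [seq u 0 i | i <- enum 'I_n].
have envE u : \row_(i < n) (env u)`_i = u.
  by apply/rowP => i; rewrite mxE (nth_map i) ?size_enum_ord // nth_ord_enum.
have := GRing.quantifier_elim_wf (@ClosedFieldQE.wf_ex_elim K)
  (GRing.to_rform_rformula f).
rewrite -/qe => /andP[qf rf].
have qeP u : GRing.qf_eval (env u) qe <-> P u.
  rewrite -(rwP (GRing.quantifier_elim_rformP (@ClosedFieldQE.wf_ex_elim K)
    (ClosedFieldQE.holds_ex_elim closedK) _ (GRing.to_rform_rformula f))).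
  by rewrite GRing.to_rformP fP envE.
suff : generically_decided [set u | GRing.qf_eval (env u) qe].
  by congr generically_decided; apply/seteqP; split=> u /qeP.
have term t : GRing.rterm t -> exists g, forall u, GRing.eval (env u) t = peval g u.
  elim: t => //= [i|c|k|s IHs t IHt /andP[/IHs[g sg] /IHt[h th]]|
    t IHt /IHt[g tg]|t IHt k /IHt[g tg]|s IHs t IHt /andP[/IHs[g sg] /IHt[h th]]|
    t IHt k /IHt[g tg]].
  - have [ltin|leni] := ltnP i n.
      exists 'X_(Ordinal ltin) => u; rewrite /peval mevalXU.
      by have /rowP/(_ (Ordinal ltin)) := envE u; rewrite mxE.
    by exists 0 => u; rewrite /peval meval0 nth_default // size_map size_enum_ord.
  - by exists c%:MP => u; rewrite /peval mevalC.
  - by exists k%:R%:MP => u; rewrite /peval mevalC.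
  - by exists (g + h) => u; rewrite /peval mevalD sg th.
  - by exists (- g) => u; rewrite /peval mevalN tg.
  - by exists (g *+ k) => u; rewrite /peval mevalMn tg.
  - by exists (g * h) => u; rewrite /peval mevalM sg th.
  - by exists (g ^+ k) => u; rewrite /peval rmorphXn /= tg.
move: qe qf rf {qeP}; elim=> //=.
- move=> b _ _; case: b; first by left; apply: general_sub (@generalT K n).
  by right; apply: general_sub (@generalT K n).
- move=> s t _ /andP[/term[g sg] /term[h th]].
  rewrite (_ : mkset _ = [set u | peval (g - h) u = 0]); first exact: decided_eq.
  apply/seteqP; split=> u /=; rewrite sg th /peval mevalB.
    by move/eqP->; rewrite subrr.
  by move/eqP; rewrite subr_eq0.
- move=> f1 IH1 f2 IH2 /andP[q1 q2] /andP[r1 r2].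
  rewrite (_ : mkset _ = [set u | GRing.qf_eval (env u) f1] `&`
    [set u | GRing.qf_eval (env u) f2]).
    by apply: decidedI; [exact: IH1|exact: IH2].
  by apply/seteqP; split=> u /= => [/andP[]|[-> ->]].
- move=> f1 IH1 f2 IH2 /andP[q1 q2] /andP[r1 r2].
  rewrite (_ : mkset _ = [set u | GRing.qf_eval (env u) f1] `|`
    [set u | GRing.qf_eval (env u) f2]).
    by apply: decidedU; [exact: IH1|exact: IH2].
  by apply/seteqP; split=> u /= => [/orP[]|[->|->]]; rewrite ?orbT; auto.
- move=> f1 IH1 f2 IH2 /andP[q1 q2] /andP[r1 r2].
  rewrite (_ : mkset _ = ~` [set u | GRing.qf_eval (env u) f1] `|`
    [set u | GRing.qf_eval (env u) f2]).
    by apply: decidedU; [apply: decidedC; exact: IH1|exact: IH2].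
  apply/seteqP; split=> u /= => [|[/negP/negPf->//|->]]; last by rewrite implybT.
  by case: (GRing.qf_eval (env u) f1) => /= h; [right|left].
- move=> f1 IH1 q1 r1.
  rewrite (_ : mkset _ = ~` [set u | GRing.qf_eval (env u) f1]).
    by apply: decidedC; exact: IH1.
  by apply/seteqP; split=> u /= /negP.
Qed.

End Definable.

(** * Toric charts of an affine cone *)

Section ToricChart.
Variables (K : numFieldType) (N : nat).

Definition monomial_at (m : 'X_{1.. N}) (z : 'rV[K]_N) : K := peval 'X_[m] z.

(** Where the pole coordinate of the cone does not vanish, its points are
    [z_pole * z ^ expo l], with monomials [z ^ expo l] in the base coordinates
    only; the base coordinate [z_p] of [w] is the quotient [w_p / w_pole]. The
    remaining coordinates of [z] will parametrise the conormal covectors. *)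
Record toric_chart (C : set 'rV[K]_N) := ToricChart {
  pole : 'I_N;
  base : {set 'I_N};
  expo : 'I_N -> 'X_{1.. N};
  expo_pole : expo pole = 0%MM;
  expo_base : forall l, l \in base -> expo l = U_(l)%MM;
  expo_support : forall l r, r \notin base -> expo l r = 0%N;
  chart_in : forall z : 'rV[K]_N, z 0 pole != 0 ->
    C (\row_l (z 0 pole * monomial_at (expo l) z));
  chart_onto : forall w : 'rV[K]_N, C w -> w 0 pole != 0 ->
    exists z : 'rV[K]_N, w = \row_l (z 0 pole * monomial_at (expo l) z);
  chart_dense : forall f : {mpoly K[N]},
    (forall w, C w -> w 0 pole != 0 -> peval f w = 0) ->
    forall w, C w -> peval f w = 0
}.

Variables (C : set 'rV[K]_N) (c : toric_chart C).
Implicit Types (w z a v : 'rV[K]_N).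
Notation l0 := (pole c).
Notation S := (base c).
Notation M l := ('X_[expo c l] : {mpoly K[N]}).

Definition chart (z : 'rV[K]_N) : 'rV[K]_N :=
  \row_l (z 0 l0 * monomial_at (expo c l) z).

Lemma pole_notin_base : l0 \notin S.
Proof.
apply/negP => /expo_base; rewrite expo_pole => /mnmP/(_ l0).
by rewrite mnm0E mnm1E eqxx.
Qed.

Lemma big_pole_base (V : nmodType) (g : 'I_N -> V) :
  \sum_l g l = g l0 + \sum_(p in S) g p + \sum_(r in ~: (l0 |: S)) g r.
Proof.
rewrite (bigID (mem (l0 |: S))) /=; congr (_ + _).
  by rewrite (big_setU1 _ pole_notin_base).
by apply: eq_bigl => i; rewrite !inE.
Qed.

Lemma monomial_pole z : monomial_at (expo c l0) z = 1.
Proof. by rewrite /monomial_at expo_pole /peval mpolyX0 meval1. Qed.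

Lemma monomial_base l (z : 'rV[K]_N) : l \in S -> monomial_at (expo c l) z = z 0 l.
Proof. by move=> lS; rewrite /monomial_at expo_base // /peval mevalXU. Qed.

Lemma monomial_eq l (y z : 'rV[K]_N) : (forall p, p \in S -> y 0 p = z 0 p) ->
  monomial_at (expo c l) y = monomial_at (expo c l) z.
Proof.
move=> yz; rewrite /monomial_at /peval !mevalX; apply: eq_bigr => r _.
by have [/yz->//|/expo_support->] := boolP (r \in S); rewrite !expr0.
Qed.

Lemma mderiv_pole i : (M l0)^`M(i) = 0.
Proof. by rewrite expo_pole mderivX mnm0E scale0r. Qed.

Lemma mderiv_base p i : p \in S -> (M p)^`M(i) = (p == i)%:R.
Proof.
move=> pS; rewrite expo_base // mderivX mnm1E; case: eqP => [->|_].
  by rewrite scale1r -[X in (X - _)%MM]add0m addmK mpolyX0.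
by rewrite scale0r.
Qed.

Lemma mderiv_expo l i : i \notin S -> (M l)^`M(i) = 0.
Proof. by move=> iS; rewrite mderivX expo_support // scale0r. Qed.

Lemma chart_pole z : chart z 0 l0 = z 0 l0.
Proof. by rewrite mxE monomial_pole mulr1. Qed.

Lemma chart_base z p : p \in S -> chart z 0 p = z 0 l0 * z 0 p.
Proof. by move=> pS; rewrite mxE monomial_base. Qed.

Lemma chart_in_cone z : z 0 l0 != 0 -> C (chart z).
Proof. exact: chart_in. Qed.

Lemma chart_surjective w : C w -> w 0 l0 != 0 -> exists2 z, w = chart z & z 0 l0 != 0.
Proof.
by move=> Cw w0; have [z wz] := chart_onto Cw w0; exists z; rewrite // -chart_pole /chart -wz.
Qed.

(** The equations [w_l / w_pole = monomial in the w_p / w_pole], homogenised: they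
    cut out the tangent spaces. *)
Definition chart_relation l : {mpoly K[N]} :=
  'X_l * 'X_l0 ^+ mdeg (expo c l) - 'X_l0 * M l.

Lemma chart_relation_vanishes l : vanishing_ideal C (chart_relation l).
Proof.
apply: (@chart_dense _ c) => w Cw w0; have [z -> z0] := chart_surjective Cw w0.
rewrite /peval /chart_relation mevalB !mevalM rmorphXn /= !mevalXU chart_pole.
rewrite mxE -mulrA -mulrBr; apply/eqP; rewrite mulf_eq0 subr_eq0 (negPf z0) /=.
rewrite mulrC /monomial_at /peval !mevalX mdegE -prodrXr -big_split /=.
apply/eqP/eq_bigr => r _; have [rS|rS] := boolP (r \in S).
  by rewrite chart_base // exprMn.
by rewrite expo_support // !expr0 mulr1.
Qed.

Definition tangent_vector (z a : 'rV[K]_N) : 'rV[K]_N :=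
  \row_l (a 0 l0 * monomial_at (expo c l) z
          + \sum_(p in S) a 0 p * peval (M l)^`M(p) z).

Lemma tangent_vector_pole z a : tangent_vector z a 0 l0 = a 0 l0.
Proof.
rewrite mxE monomial_pole mulr1 big1 ?addr0 // => p _.
by rewrite mderiv_pole /peval meval0 mulr0.
Qed.

Lemma tangent_vector_base z a p : p \in S ->
  tangent_vector z a 0 p = a 0 l0 * z 0 p + a 0 p.
Proof.
move=> pS; rewrite mxE monomial_base // (bigD1 p) //= big1 ?addr0 => [|q].
  by rewrite mderiv_base // eqxx /peval meval1 mulr1.
move=> /andP[_ qp]; rewrite mderiv_base // eq_sym (negPf qp) /peval.
by rewrite meval0 mulr0.
Qed.

(** Velocity at [t = 0] of the curve [chart (z + t b)] inside the cone. *)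
Lemma tangent_vector_in z a : z 0 l0 != 0 ->
  tangent_space C (chart z) (tangent_vector z a).
Proof.
move=> z0 f If.
pose b i := if i == l0 then a 0 l0 else a 0 i / z 0 l0.
pose h l := along (line (z 0) b) ('X_l0 * M l).
have hE l t : (h l).[t] = chart (\row_i (z 0 i + t * b i)) 0 l.
  rewrite along_lineE mevalM mevalXU !mxE /monomial_at /peval; congr (_ * _).
  by apply: meval_eq => i; rewrite mxE.
have fh0 : along h f = 0.
  apply: (@poly_eq0_cofinite _ _ (line (z 0) b l0)) => [|t].
    apply: contra_neq z0 => /(congr1 (horner^~ 0)).
    by rewrite horner_line mul0r addr0 horner0.
  rewrite horner_line => zt0; rewrite horner_along.
  rewrite (meval_eq (v2 := fun l => chart (\row_i (z 0 i + t * b i)) 0 l)) //.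
  by apply: If; apply: chart_in_cone; rewrite mxE.
have h0 l : (h l).[0] = chart z 0 l.
  rewrite hE; congr (chart _ 0 l); apply/rowP => i.
  by rewrite mxE mul0r addr0.
have := congr1 (fun p => p^`().[0]) fh0.
rewrite /= deriv0 horner0 deriv_along horner_sum => E; apply: etrans E.
apply: eq_bigr => l _.
rewrite hornerM horner_along; congr (_ * _); first exact: meval_eq.
rewrite deriv_along horner_sum mxE.
have zE f' : (along (line (z 0) b) f').[0] = peval f' z.
  by rewrite along_lineE; apply: meval_eq => i; rewrite mul0r addr0.
apply: esym; under eq_bigr => i _ do rewrite deriv_line hornerM hornerC zE mderivM /peval mevalD
  !mevalM mevalXU mulrDl.
rewrite big_split /=; congr (_ + _).
  rewrite (bigD1 l0) //= big1 => [|i il0].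
    rewrite mderivX mnm1E eqxx scale1r -[X in (X - _)%MM]add0m addmK mpolyX0.
    by rewrite meval1 mul1r addr0 /b eqxx mulrC.
  by rewrite mderivX mnm1E eq_sym (negPf il0) scale0r meval0 !mul0r.
rewrite (bigID (mem S)) /= [X in _ + X]big1 ?addr0 => [|i iS]; last first.
  by rewrite mderiv_expo // meval0 mulr0 mul0r.
apply: eq_bigr => p pS; rewrite /b ifN.
  by rewrite mulrC mulrA divfK.
by apply: contraNneq pole_notin_base => <-.
Qed.

(** Modulo tangent vectors of the chart, a tangent vector has zero pole and base
    coordinates, and the differentials of the [chart_relation]s kill the others. *)
Lemma tangent_vector_onto z v : z 0 l0 != 0 -> tangent_space C (chart z) v ->
  exists a, v = tangent_vector z a.
Proof.
move=> z0 Tv.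
pose a := \row_i if i == l0 then v 0 l0 else v 0 i - v 0 l0 * z 0 i.
have a0 : a 0 l0 = v 0 l0 by rewrite mxE eqxx.
exists a; pose v' := v - tangent_vector z a.
suff v'0 : v' = 0 by apply/eqP; rewrite -subr_eq0 -/v' v'0.
have v'S p : p \in l0 |: S -> v' 0 p = 0.
  rewrite !inE => /predU1P[->|pS]; rewrite mxE [X in _ + X]mxE.
    by rewrite tangent_vector_pole a0 subrr.
  have pl0 : p != l0 by apply: contraNneq pole_notin_base => <-.
  by rewrite tangent_vector_base // a0 mxE (negPf pl0) [_ * _ + _]addrC subrK subrr.
have Tv' : tangent_space C (chart z) v'.
  move=> f If; rewrite -[RHS](subrr 0) -[X in _ = X - _](Tv f If).
  rewrite -[X in _ = _ - X](tangent_vector_in a z0 If) -sumrB.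
  by apply: eq_bigr => i _; rewrite -mulrBr mxE [X in _ + X]mxE.
apply/rowP => l; rewrite [RHS]mxE.
have [/v'S//|lS] := boolP (l \in l0 |: S).
have := Tv' _ (@chart_relation_vanishes l).
rewrite (bigD1 l) //= big1 ?addr0 => [|i il]; last first.
  have [/v'S->|iS] := boolP (i \in l0 |: S); first by rewrite mulr0.
  move: iS; rewrite !inE negb_or => /andP[il0 iS].
  rewrite /chart_relation mderivB !mderivM mderiv_expo // mulr0 addr0.
  have dX r : i != r -> ('X_r : {mpoly K[N]})^`M(i) = 0.
    by move=> ir; rewrite mderivX mnm1E eq_sym (negPf ir) scale0r.
  have dXn k : ('X_l0 ^+ k : {mpoly K[N]})^`M(i) = 0.
    elim: k => [|k IH]; first by rewrite expr0 -mpolyC1 mderivC.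
    by rewrite exprS mderivM dX // IH mulr0 mul0r addr0.
  by rewrite dX // dX // dXn mulr0 !mul0r addr0 subr0 /peval meval0 mul0r.
move: lS; rewrite !inE negb_or => /andP[ll0 lS].
rewrite /chart_relation mderivB !mderivM mderiv_expo // mulr0 addr0.
have dX r : ('X_r : {mpoly K[N]})^`M(l) = (r == l)%:R.
  rewrite mderivX mnm1E; case: eqP => [->|_]; last by rewrite scale0r.
  by rewrite scale1r -[X in (X - _)%MM]add0m addmK mpolyX0.
have dXn k : ('X_l0 ^+ k : {mpoly K[N]})^`M(l) = 0.
  elim: k => [|k IH]; first by rewrite expr0 -mpolyC1 mderivC.
  by rewrite exprS mderivM dX eq_sym (negPf ll0) IH mulr0 mul0r addr0.
rewrite !dX dXn eqxx eq_sym (negPf ll0) mul1r mulr0 addr0 mul0r subr0.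
rewrite /peval rmorphXn /= mevalXU chart_pole => /eqP.
by rewrite mulf_eq0 expf_eq0 (negPf z0) andbF /= => /eqP.
Qed.

(** ** Dimension and smoothness *)

Definition coordinate (i : 'I_#|S|.+1) : 'I_N :=
  oapp (fun k : 'I_#|S| => enum_val k) l0 (unlift ord0 i).

Lemma coordinate0 : coordinate ord0 = l0.
Proof. by rewrite /coordinate unlift_none. Qed.

Lemma coordinateS k : coordinate (lift ord0 k) = enum_val k.
Proof. by rewrite /coordinate liftK. Qed.

Lemma coordinate_inj : injective coordinate.
Proof.
have lS k : l0 != @enum_val _ (mem S) k.
  by apply: contraNneq pole_notin_base => ->; apply: enum_valP.
move=> i j; case: (unliftP ord0 i) => [k ->|->];
  case: (unliftP ord0 j) => [k' ->|->]; rewrite ?coordinate0 ?coordinateS //.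
- by move/enum_val_inj->.
- by move/esym/eqP; rewrite (negPf (lS k)).
- by move/eqP; rewrite (negPf (lS k')).
Qed.

Lemma coordinate_base p : p \in S -> exists i, p = coordinate i.
Proof.
by move=> pS; exists (lift ord0 (enum_rank_in pS p)); rewrite coordinateS enum_rankK_in.
Qed.

Definition spread (V : nmodType) (x : 'I_#|S|.+1 -> V) (l : 'I_N) : V :=
  \sum_(i | coordinate i == l) x i.

Lemma spread_coordinate (V : nmodType) (x : 'I_#|S|.+1 -> V) i :
  spread x (coordinate i) = x i.
Proof.
by rewrite /spread (big_pred1 i) // => j; rewrite (inj_eq coordinate_inj).
Qed.

Lemma chart_coordinates_independent :
  alg_independent C (fun i => 'X_(coordinate i)).
Proof.
move=> P PC; suff : P * 'X_ord0 == 0.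
  rewrite mulf_eq0 => /orP[/eqP//|]; rewrite -msize_poly_eq0 msizeX //.
apply/eqP/mpoly_eq0_meval => x; rewrite mevalM mevalXU.
have [->|x0] := eqVneq (x ord0) 0; first by rewrite mulr0.
pose y i := if i == ord0 then x ord0 else x i / x ord0.
pose z : 'rV[K]_N := \row_l spread y l.
have zy i : z 0 (coordinate i) = y i by rewrite mxE spread_coordinate.
have z0 : z 0 l0 = x ord0 by rewrite -coordinate0 zy /y eqxx.
rewrite (meval_eq (v2 := fun i => peval 'X_(coordinate i) (chart z))).
  by rewrite PC ?mul0r //; apply: chart_in_cone; rewrite z0.
move=> i; rewrite /peval mevalXU; case: (unliftP ord0 i) => [k ->|->].
  rewrite coordinateS chart_base ?enum_valP // -coordinateS zy z0 /y /=.
  by rewrite mulrC divfK.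
by rewrite coordinate0 chart_pole z0.
Qed.

(** The pole and base coordinates are independent on the cone, because they take
    all values with nonzero pole coordinate; more functions are dependent on the
    chart by [algebraic_dependence], hence on the cone as the chart is dense. *)
Lemma chart_dimension : has_dim C #|S|.+1.
Proof.
split; first by exists (fun i => 'X_(coordinate i)); exact: chart_coordinates_independent.
move=> f fI; pose Z l : {mpoly K[#|S|.+1]} := spread (fun i => 'X_i) l.
pose G l := 'X_ord0 * mmap (@mpolyC _ K) Z (M l).
have [P PN0 GP] := algebraic_dependence (fun i => mmap (@mpolyC _ K) G (f i)).
case/negP: PN0; apply/eqP; apply: fI => w Cw.
rewrite -(meval_subst f P (w 0)).
apply: (@chart_dense _ c) Cw => {}w Cw w0; have [z -> z0] := chart_surjective Cw w0.
pose t i := z 0 (coordinate i).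
have GE l : (G l).@[t] = chart z 0 l.
  rewrite mevalM mevalXU /t coordinate0 mxE; congr (_ * _).
  rewrite meval_subst -(@monomial_eq l (\row_r (Z r).@[t])) => [|p /coordinate_base[i ->]].
    by rewrite /monomial_at /peval; apply: meval_eq => r; rewrite mxE.
  by rewrite mxE /Z spread_coordinate mevalXU.
have := congr1 (meval t) GP; rewrite meval_subst meval0 => E.
rewrite /peval meval_subst -[RHS]E; apply: meval_eq => i.
by rewrite meval_subst; apply: meval_eq => l; rewrite GE.
Qed.

Lemma tangent_vector_coordinates z a :
  tangent_vector z a = (\row_i a 0 (coordinate i)) *m
    (\matrix_(i < #|S|.+1, l < N)
       if i == ord0 then monomial_at (expo c l) z
       else peval (M l)^`M(coordinate i) z).
Proof.
apply/rowP => l; rewrite !mxE big_ord_recl !mxE coordinate0 eqxx.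
congr (_ + _); rewrite big_enum_val; apply: eq_bigr => k _.
by rewrite !mxE coordinateS.
Qed.

(** The tangent space is the image of an injective linear map from a space of the
    dimension of the cone. *)
Lemma chart_smooth z : z 0 l0 != 0 -> smooth_locus C (chart z).
Proof.
move=> z0; split; first exact: chart_in_cone.
pose B := \matrix_(i < #|S|.+1, l < N)
       (if i == ord0 then monomial_at (expo c l) z
       else peval (M l)^`M(coordinate i) z).
have BE (x : 'rV_#|S|.+1) : x *m B = tangent_vector z (\row_l spread (x 0) l).
  rewrite tangent_vector_coordinates; congr (_ *m _); apply/rowP => i.
  by rewrite !mxE spread_coordinate.
pose f : 'Hom('rV[K]_#|S|.+1, 'rV[K]_N) := linfun (mulmxr B).
have kerf : lker f = 0%VS.
  apply/eqP/lker0P => x y; rewrite !lfunE /= => /eqP; rewrite -subr_eq0 -mulmxBl.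
  rewrite BE => /eqP T0; apply/eqP; rewrite -subr_eq0; apply/eqP/rowP => i.
  rewrite [RHS]mxE.
  have E0 : (x - y) 0 ord0 = 0.
    have := tangent_vector_pole z (\row_l spread ((x - y) 0) l).
    by rewrite T0 mxE mxE -coordinate0 spread_coordinate => <-.
  case: (unliftP ord0 i) => [k ->|->//].
  have := tangent_vector_base z (\row_l spread ((x - y) 0) l) (enum_valP k).
  rewrite T0 mxE [in RHS]mxE [X in _ = _ + X]mxE -{1}coordinate0 -coordinateS.
  by rewrite !spread_coordinate E0 mul0r add0r => <-.
exists (limg f); split=> [v|]; last first.
  suff -> : \dim (limg f) = #|S|.+1 by exact: chart_dimension.
  by rewrite limg_dim_eq ?kerf ?capv0 // dimvf /dim /= mul1n.
split=> [/memv_imgP[x _ ->]|/(tangent_vector_onto z0)[a ->]].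
  by rewrite lfunE /= BE; exact: tangent_vector_in.
rewrite tangent_vector_coordinates; apply/memv_imgP.
by exists (\row_i a 0 (coordinate i)); rewrite ?memvf // lfunE.
Qed.

(** ** The equations of the critical points *)

(** A covector is conormal to the cone at [chart z] if it kills the tangent
    vectors; those have arbitrary pole and base coordinates, so the conditions
    can be solved for the pole and base coordinates of the covector. The others
    are free, and are the coordinates of [z] outside the chart. *)
Definition conormal_base p : {mpoly K[N]} :=
  - \sum_(r in ~: (l0 |: S)) 'X_r * (M r)^`M(p).

Definition conormal l : {mpoly K[N]} :=
  if l \in S then conormal_base l else
  if l == l0 then - \sum_(p in S) conormal_base p * 'X_p
                  - \sum_(r in ~: (l0 |: S)) 'X_r * M r
  else 'X_l.

(** The equation [ed_map Q z = u *m Q] says that the covector [(u - chart z) *m Q]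
    is the conormal covector with parameter [z]. *)
Definition ed_map (Q : 'M[K]_N) l : {mpoly K[N]} :=
  'X_l0 * (\sum_r Q r l *: M r) + conormal l.

Lemma peval_ed_map Q z l :
  peval (ed_map Q l) z = (chart z *m Q) 0 l + peval (conormal l) z.
Proof.
rewrite /peval mevalD mevalM mevalXU mxE (raddf_sum (meval (z 0))) mulr_sumr /=.
congr (_ + _); apply: eq_bigr => r _.
by rewrite mevalZ mxE /monomial_at /peval mulrCA mulrC.
Qed.

Lemma bform_sum (Q : 'M[K]_N) (u v : 'rV[K]_N) :
  bform Q u v = \sum_l (u *m Q) 0 l * v 0 l.
Proof. by rewrite /bform mxE; apply: eq_bigr => l _; rewrite [v^T _ _]mxE. Qed.

Lemma conormal_free z r : r \in ~: (l0 |: S) -> peval (conormal r) z = z 0 r.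
Proof.
rewrite !inE negb_or => /andP[/negPf rl0 /negPf rS].
by rewrite /conormal rS rl0 /peval mevalXU.
Qed.

Lemma sum_tangent_vector z a (eta : 'I_N -> K) :
  \sum_l eta l * tangent_vector z a 0 l =
  a 0 l0 * (\sum_l eta l * monomial_at (expo c l) z) +
  \sum_(p in S) a 0 p * (\sum_l eta l * peval (M l)^`M(p) z).
Proof.
under eq_bigr => l _ do rewrite mxE mulrDr mulrCA.
rewrite big_split /= -mulr_sumr; congr (_ + _).
under eq_bigr => l _ do rewrite mulr_sumr.
rewrite exchange_big /=; apply: eq_bigr => p _.
by rewrite mulr_sumr; apply: eq_bigr => l _; rewrite mulrCA.
Qed.

Lemma sum_monomial z (eta : 'I_N -> K) :
  \sum_l eta l * monomial_at (expo c l) z =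
  eta l0 + \sum_(p in S) eta p * z 0 p +
  \sum_(r in ~: (l0 |: S)) eta r * monomial_at (expo c r) z.
Proof.
rewrite big_pole_base monomial_pole mulr1; congr (_ + _ + _).
by apply: eq_bigr => p pS; rewrite monomial_base.
Qed.

Lemma sum_mderiv z (eta : 'I_N -> K) p : p \in S ->
  \sum_l eta l * peval (M l)^`M(p) z =
  eta p + \sum_(r in ~: (l0 |: S)) eta r * peval (M r)^`M(p) z.
Proof.
move=> pS; rewrite big_pole_base mderiv_pole /peval meval0 mulr0 add0r.
congr (_ + _); rewrite (bigD1 p) //= mderiv_base // eqxx meval1 mulr1.
rewrite big1 ?addr0 // => q /andP[qS qp].
by rewrite mderiv_base // (negPf qp) meval0 mulr0.
Qed.

Lemma peval_conormal_base z p : p \in S -> peval (conormal p) z =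
  - \sum_(r in ~: (l0 |: S)) z 0 r * peval (M r)^`M(p) z.
Proof.
move=> pS; rewrite /conormal pS /conormal_base /peval mevalN.
rewrite (raddf_sum (meval (z 0))) /=; congr (- _); apply: eq_bigr => r _.
by rewrite mevalM mevalXU.
Qed.

Lemma peval_conormal_pole z : peval (conormal l0) z =
  - (\sum_(p in S) peval (conormal p) z * z 0 p)
  - \sum_(r in ~: (l0 |: S)) z 0 r * monomial_at (expo c r) z.
Proof.
rewrite {1}/conormal (negPf pole_notin_base) eqxx /peval mevalB mevalN.
rewrite !(raddf_sum (meval (z 0))) /=; congr (- _ - _).
  by apply: eq_bigr => p pS; rewrite mevalM mevalXU /conormal pS.
by apply: eq_bigr => r _; rewrite mevalM mevalXU.
Qed.

Definition normal_at Q u w :=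
  forall v, tangent_space C w v -> bform Q (u - w) v = 0.

Lemma ed_map_normal (Q : 'M[K]_N) (u z : 'rV[K]_N) : z 0 l0 != 0 ->
  (forall l, peval (ed_map Q l) z = (u *m Q) 0 l) -> normal_at Q u (chart z).
Proof.
move=> z0 uz v /(tangent_vector_onto z0)[a ->].
rewrite bform_sum; under eq_bigr => l _.
  rewrite mulmxBl mxE [X in _ + X]mxE -uz peval_ed_map [_ + peval _ _]addrC addrK.
  over.
rewrite sum_tangent_vector sum_monomial peval_conormal_pole.
have V (F : 'I_N -> K) : \sum_(r in ~: (l0 |: S)) peval (conormal r) z * F r =
    \sum_(r in ~: (l0 |: S)) z 0 r * F r.
  by apply: eq_bigr => r rV; rewrite conormal_free.
rewrite V -addrA -opprD addNr mulr0 add0r big1 // => p pS.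
by rewrite sum_mderiv // V peval_conormal_base // addNr mulr0.
Qed.

Lemma normal_ed_map (Q : 'M[K]_N) (u z : 'rV[K]_N) : z 0 l0 != 0 ->
  normal_at Q u (chart z) ->
  exists z', [/\ z' 0 l0 = z 0 l0, chart z' = chart z &
    forall l, peval (ed_map Q l) z' = (u *m Q) 0 l].
Proof.
move=> z0 nz; pose eta l := ((u - chart z) *m Q) 0 l.
pose z' : 'rV[K]_N := \row_l if l \in ~: (l0 |: S) then eta l else z 0 l.
have z'0 : z' 0 l0 = z 0 l0 by rewrite mxE !inE eqxx.
have z'S p : p \in S -> z' 0 p = z 0 p by move=> pS; rewrite mxE !inE pS orbT.
have mz l : monomial_at (expo c l) z' = monomial_at (expo c l) z.
  by apply: monomial_eq => p /z'S.
have cz : chart z' = chart z by apply/rowP => l; rewrite [LHS]mxE [RHS]mxE z'0 mz.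
have dz l p : peval (M l)^`M(p) z' = peval (M l)^`M(p) z.
  rewrite mderivX /peval !mevalZ !mevalX; congr (_ * _); apply: eq_bigr => r _.
  by have [/z'S->//|rS] := boolP (r \in S); rewrite mnmBE expo_support.
exists z'; split=> // l; rewrite peval_ed_map cz.
suff -> : peval (conormal l) z' = eta l.
  have subE (v w : 'rV[K]_N) : (v - w) 0 l = v 0 l - w 0 l by rewrite !mxE.
  by rewrite /eta mulmxBl subE addrC subrK.
have V (F : 'I_N -> K) : \sum_(r in ~: (l0 |: S)) z' 0 r * F r =
    \sum_(r in ~: (l0 |: S)) eta r * F r.
  by apply: eq_bigr => r rV; rewrite mxE rV.
have orth a : a 0 l0 * (\sum_l eta l * monomial_at (expo c l) z) +
    \sum_(p in S) a 0 p * (\sum_l eta l * peval (M l)^`M(p) z) = 0.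
  rewrite -sum_tangent_vector; apply: (etrans _ (nz _ (tangent_vector_in a z0))).
  by rewrite bform_sum.
have conS p : p \in S -> peval (conormal p) z' = eta p.
  move=> pS; rewrite peval_conormal_base // V; apply/eqP; rewrite eq_sym -addr_eq0.
  have pl0 : (l0 == p) = false.
    by apply/negbTE; apply: contraNneq pole_notin_base => ->.
  have := orth (delta_mx 0 p); rewrite mxE eqxx pl0 mul0r add0r.
  rewrite (bigD1 p) //= [X in _ + X]big1 ?addr0 => [|q /andP[_ qp]]; last first.
    by rewrite mxE eqxx (negPf qp) mul0r.
  rewrite mxE !eqxx mul1r sum_mderiv // => E; apply/eqP; apply: etrans E; congr (_ + _).
  by apply: eq_bigr => r _; rewrite dz.
have [lS|lS] := boolP (l \in S); first exact: conS.
have [->|ll0] := eqVneq l l0; last first.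
  by rewrite conormal_free ?mxE !inE ?negb_or ?ll0 //= lS.
rewrite peval_conormal_pole V; apply/eqP; rewrite -opprD eq_sym -addr_eq0 addrA.
have := orth (delta_mx 0 l0); rewrite mxE !eqxx mul1r [X in _ + X]big1 ?addr0 => [|p pS].
  rewrite sum_monomial => E; apply/eqP; apply: etrans E; congr (_ + _ + _).
    by apply: eq_bigr => p pS; rewrite conS // z'S.
  by apply: eq_bigr => r _; rewrite mz.
have pl0 : (p == l0) = false by apply/negbTE; apply: contraNneq pole_notin_base => <-.
by rewrite mxE eqxx pl0 mul0r.
Qed.

End ToricChart.

(** * Counting critical points for general data *)

Section PolynomialFunctions.
Variable K : numClosedFieldType.

Definition polynomial_function n (h : 'rV[K]_n -> K) :=
  exists f : {mpoly K[n]}, forall x, h x = peval f x.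

Lemma polynomial_comp n m (g : {mpoly K[m]}) (h : 'rV[K]_n -> 'rV[K]_m) :
  (forall i, polynomial_function (fun x => h x 0 i)) ->
  polynomial_function (fun x => peval g (h x)).
Proof.
move=> /choice[f fh]; exists (mmap (@mpolyC n K) f g) => x.
by rewrite /peval meval_subst; apply: meval_eq => i; rewrite fh.
Qed.

Lemma polynomial_coordinate n i : polynomial_function (fun x : 'rV[K]_n => x 0 i).
Proof. by exists 'X_i => x; rewrite /peval mevalXU. Qed.

Lemma polynomialB n (g h : 'rV[K]_n -> K) : polynomial_function g ->
  polynomial_function h -> polynomial_function (fun x => g x - h x).
Proof. by move=> [f fg] [f' fh]; exists (f - f') => x; rewrite /peval mevalB fg fh. Qed.

Lemma polynomialM n (g h : 'rV[K]_n -> K) : polynomial_function g ->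
  polynomial_function h -> polynomial_function (fun x => g x * h x).
Proof. by move=> [f fg] [f' fh]; exists (f * f') => x; rewrite /peval mevalM fg fh. Qed.

Lemma polynomial_row_mulmx n m (h : 'rV[K]_n -> 'rV[K]_m) (A : 'M[K]_m) i :
  (forall i, polynomial_function (fun x => h x 0 i)) ->
  polynomial_function (fun x => (h x *m A) 0 i).
Proof.
move=> /choice[f fh]; exists (\sum_j A j i *: f j) => x.
rewrite /peval (raddf_sum (meval (x 0))) mxE; apply: eq_bigr => j _ /=.
by rewrite mevalZ fh mulrC.
Qed.

Lemma definable_zero n (h : 'rV[K]_n -> K) :
  polynomial_function h -> definable [set x | h x = 0].
Proof.
by move=> [f fh]; apply: definable_iff (definable_peval f) => x /=; rewrite fh.
Qed.

Lemma general_mulmx n (A : 'M[K]_n) (g : {mpoly K[n]}) : A \in unitmx ->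
  g != 0 -> general [set u | peval g (u *m A) != 0].
Proof.
move=> Aunit gN0.
have [f fE] : polynomial_function (fun u => peval g (u *m A)).
  apply: polynomial_comp => i; apply: polynomial_row_mulmx => j.
  exact: polynomial_coordinate.
exists f => [|u]; last by rewrite /= fE.
have [x gx] := mpoly_neq0_meval gN0; apply: contra_neq gx => f0.
have := fE (\row_i x i *m invmx A); rewrite f0 mulmxKV // /peval meval0 => <-.
by apply: meval_eq => i; rewrite mxE.
Qed.

End PolynomialFunctions.

Section CriticalPoints.
Variables (K : numClosedFieldType) (N : nat) (C : set 'rV[K]_N).
Variables (I : finType) (cs : I -> toric_chart C) (i0 : I).
Hypothesis cover : forall w, C w -> w != 0 -> exists i, w 0 (pole (cs i)) != 0.
Variable Q : 'M[K]_N.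
Hypothesis Qunit : Q \in unitmx.

(** The [critical_points] for a complex Gram matrix and a given cone. *)
Definition critical (u : 'rV[K]_N) : set 'rV[K]_N :=
  [set w | smooth_locus C w /\ normal_at C Q u w].

(** The points over [u] of the incidence variety of data and critical points, in
    the coordinates of a chart. *)
Definition ed_point i (u z : 'rV[K]_N) :=
  z 0 (pole (cs i)) != 0 /\ forall l, peval (ed_map (cs i) Q l) z = (u *m Q) 0 l.

(** Lines of the cone are tangent to it at its vertex, so the vertex can only be
    critical for the data orthogonal to all of them. *)
Lemma vertex_not_critical : general [set u | ~ critical u 0].
Proof.
pose z : 'rV[K]_N := delta_mx 0 (pole (cs i0)).
have z0 : z 0 (pole (cs i0)) = 1 by rewrite mxE !eqxx.
pose w := chart (cs i0) z.
have w0 : w 0 (pole (cs i0)) = 1 by rewrite chart_pole.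
have Tw : tangent_space C 0 w.
  move=> f If.
  have f0 : along (line (fun=> 0) (w 0)) f = 0.
    apply: (@poly_eq0_cofinite _ _ 'X) => [|t]; first by rewrite polyX_eq0.
    rewrite hornerX along_lineE => tN0.
    pose zt : 'rV[K]_N := \row_l if l == pole (cs i0) then t else z 0 l.
    have zt0 : zt 0 (pole (cs i0)) = t by rewrite mxE eqxx.
    rewrite (meval_eq (v2 := chart (cs i0) zt 0)).
      by apply: If; apply: chart_in_cone; rewrite zt0.
    move=> l; rewrite add0r [LHS]/= [in LHS]mxE z0 mul1r [RHS]mxE zt0.
    congr (_ * _); apply: monomial_eq => p pS; rewrite [RHS]mxE ifN //.
    by apply: contraNneq (pole_notin_base (cs i0)) => <-.
  have := congr1 (fun p => p^`().[0]) f0.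
  rewrite /= deriv0 horner0 deriv_along horner_sum => E; apply: etrans E.
  apply: eq_bigr => i _; rewrite deriv_line hornerM hornerC along_lineE.
  congr (_ * _); apply: meval_eq => l; rewrite mul0r addr0.
  by rewrite mxE.
pose g : {mpoly K[N]} := \sum_l w 0 l *: 'X_l.
have gN0 : g != 0.
  have : peval g (delta_mx 0 (pole (cs i0))) != 0.
    rewrite /peval (raddf_sum (meval _)) (bigD1 (pole (cs i0))) //= big1 ?addr0.
      by rewrite mevalZ mevalXU w0 mul1r mxE !eqxx oner_eq0.
    move=> l ll0; rewrite mevalZ mevalXU [delta_mx _ _ _ _]mxE eqxx.
    by rewrite (negPf ll0) mulr0.
  by apply: contra_neq => ->; rewrite /peval meval0.
apply: general_sub (general_mulmx Qunit gN0) => u /= /eqP gu [_ /(_ w Tw)].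
rewrite subr0 bform_sum => E; apply: gu; rewrite -[RHS]E.
rewrite /peval (raddf_sum (meval _)); apply: eq_bigr => l _ /=.
by rewrite mevalZ mevalXU mulrC.
Qed.

Lemma ed_point_critical i u z : ed_point i u z -> critical u (chart (cs i) z).
Proof.
by move=> [z0 uz]; split; [exact: chart_smooth|exact: ed_map_normal].
Qed.

Lemma critical_ed_point u w : ~ critical u 0 -> critical u w ->
  exists i z, ed_point i u z /\ w = chart (cs i) z.
Proof.
move=> nu0 cw; have wN0 : w != 0 by apply/eqP => w0; apply: nu0; rewrite -w0.
have [[Cw _] nw] := cw; have [i wi] := cover Cw wN0.
have [z wz z0] := chart_surjective Cw wi; rewrite wz in nw.
have [z' [z'0 zz' uz']] := normal_ed_map z0 nw.
by exists i, z'; split; [split; rewrite ?z'0|rewrite zz'].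
Qed.

(** The critical points are given by their chart coordinates, so that the property
    is first-order in [u]. *)
Definition at_least m u := exists k : {ffun 'I_m -> I}, exists z : 'M[K]_(m, N),
  (forall a, ed_point (k a) u (row a z)) /\
  (forall a b, a != b -> chart (cs (k a)) (row a z) <> chart (cs (k b)) (row b z)).

Lemma at_least_decided m : generically_decided (at_least m).
Proof.
apply: decided_exists => k.
pose zof (x : 'rV[K]_(N + m * N)) a := row a (vec_mx (rsubmx x) : 'M[K]_(m, N)).
have zP a l : polynomial_function (fun x => zof x a 0 l).
  have [f fE] := polynomial_coordinate K (rshift N (mxvec_index a l)).
  by exists f => x; rewrite -fE /zof !mxE.
have uP l : polynomial_function (fun x : 'rV[K]_(N + m * N) => lsubmx x 0 l).
  have [f fE] := polynomial_coordinate K (lshift (m * N) l).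
  by exists f => x; rewrite -fE !mxE.
have cP a l : polynomial_function (fun x => chart (cs (k a)) (zof x a) 0 l).
  have [f fE] : polynomial_function (fun x => zof x a 0 (pole (cs (k a))) *
      peval 'X_[expo (cs (k a)) l] (zof x a)).
    by apply: polynomialM => //; apply: polynomial_comp.
  by exists f => x; rewrite mxE -fE.
pose P1 := [set x | forall a, (~` [set x | zof x a 0 (pole (cs (k a))) = 0]) x] `&`
  [set x | forall a l, peval (ed_map (cs (k a)) Q l) (zof x a)
                       - (lsubmx x *m Q) 0 l = 0].
pose P2 := [set x | forall a b, a != b -> ~ (forall l,
   chart (cs (k a)) (zof x a) 0 l - chart (cs (k b)) (zof x b) 0 l = 0)].
have /definable_proj/definable_decided : definable (P1 `&` P2).
  apply: definableI; first apply: definableI.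
  - apply: definable_forall => a; apply: definableC; exact: definable_zero.
  - apply: definable_forall => a; apply: definable_forall => l.
    apply: definable_zero; apply: polynomialB; first exact: polynomial_comp.
    exact: polynomial_row_mulmx.
  - apply: definable_forall => a; apply: definable_forall => b.
    have [->|ab] := eqVneq a b.
      by exists (GRing.Bool true) => e; split=> // _; rewrite eqxx.
    apply: (@definable_iff _ _ (~` [set x | forall l,
      chart (cs (k a)) (zof x a) 0 l - chart (cs (k b)) (zof x b) 0 l = 0])).
      by move=> x /=; split=> [h _|h]; [exact: h|exact: h].
    apply: definableC; apply: definable_forall => l; apply: definable_zero.
    exact: polynomialB.
congr generically_decided; apply/seteqP; split=> u /=.
  move=> [v [[v0 uv] vv]]; exists (vec_mx v).
  have zE a : zof (row_mx u v) a = row a (vec_mx v) by rewrite /zof row_mxKr.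
  rewrite /= row_mxKl in uv; split=> [a|a b ab E].
    split; rewrite -zE; first exact/eqP/v0.
    by move=> l; apply/eqP; rewrite -subr_eq0; apply/eqP/uv.
  by apply: (vv a b ab) => l; rewrite !zE E subrr.
move=> [z [uz zz]]; exists (mxvec z); rewrite /P1 /P2 /=.
have zE a : zof (row_mx u (mxvec z)) a = row a z by rewrite /zof row_mxKr mxvecK.
rewrite row_mxKl; split; first split.
- by move=> a; rewrite zE; have [/eqP] := uz a.
- by move=> a l; rewrite zE; have [_ ->] := uz a; rewrite subrr.
- move=> a b ab E; apply: (zz a b ab); apply/rowP => l; apply/eqP.
  by rewrite -subr_eq0 -!zE E.
Qed.

(** The points in each chart lie in a single fibre of its [ed_map]. *)
Lemma at_least_bounded : exists B, general [set u | forall m, at_least m u -> (m <= B)%N].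
Proof.
have gb i := generic_fibre_bounded (ed_map (cs i) Q).
have /choice[g /choice[e ge]] : forall i, exists g : {mpoly K[N]}, exists e,
    g != 0 /\ forall u (s : seq 'rV[K]_N), g.@[u] != 0 -> uniq s ->
      (forall z, z \in s -> forall l, peval (ed_map (cs i) Q l) z = u l) ->
      (size s <= e)%N.
  by move=> i; have [g gN0 [e ge]] := gb i; exists g, e; split.
exists (\sum_i e i)%N.
have := @general_forall _ _ I (fun i => [set u | peval (g i) (u *m Q) != 0])
  (fun i => general_mulmx Qunit (proj1 (ge i))).
apply: general_sub => u gu m [k [z [uz zz]]].
rewrite -[m]card_ord -sum1_card (partition_big k predT) //=.
apply: leq_sum => i _; rewrite sum1_card cardE.
rewrite -(size_map (fun a => row a z)).
have [_] := ge i; apply; first exact: gu i.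
  rewrite map_inj_in_uniq ?enum_uniq // => a b.
  rewrite !mem_enum !unfold_in => /eqP ka /eqP kb ab; apply/eqP.
  by apply: contraT => nab; case: (zz _ _ nab); rewrite ab ka kb.
move=> y /mapP[a]; rewrite mem_enum unfold_in => /eqP ka -> l.
by have [_ <-] := uz a; rewrite ka.
Qed.

Lemma at_least_critical m u : at_least m u -> exists s : seq 'rV[K]_N,
  [/\ uniq s, size s = m & forall w, w \in s -> critical u w].
Proof.
move=> [k [z [uz zz]]].
exists [seq chart (cs (k a)) (row a z) | a <- enum 'I_m]; split.
- rewrite map_inj_uniq ?enum_uniq // => a b ab.
  by apply/eqP; apply: contraT => /zz.
- by rewrite size_map size_enum_ord.
- by move=> w /mapP[a _ ->]; apply: ed_point_critical.
Qed.

Lemma critical_at_least u (s : seq 'rV[K]_N) : ~ critical u 0 -> uniq s ->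
  (forall w, w \in s -> critical u w) -> at_least (size s) u.
Proof.
move=> nu0 us su.
have /choice[k /choice[z kz]] : forall a : 'I_(size s), exists i z,
    ed_point i u z /\ nth 0 s a = chart (cs i) z.
  by move=> a; apply: critical_ed_point => //; apply: su; rewrite mem_nth.
exists [ffun a => k a], (\matrix_a z a); split=> [a|a b ab].
  by rewrite ffunE rowK; have [] := kz a.
rewrite !ffunE !rowK -(proj2 (kz a)) -(proj2 (kz b)) => /eqP.
by rewrite nth_uniq //; apply/negP.
Qed.

Lemma card_uniq_seq (T : choiceType) (s : seq T) :
  uniq s -> [set` s] #= `I_(size s).
Proof.
move=> us; have -> : [set` s] = [set` [fset x in s]%fset].
  by apply/seteqP; split=> x; rewrite /= inE.
by apply/card_eq_fsetP; rewrite card_fseq undup_id.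
Qed.

(** For each [m], general data have at least [m] critical points, or general data
    have fewer; the number sought is the largest [m] of the first kind. *)
Theorem general_critical_count : exists m, general [set u | critical u #= `I_m].
Proof.
have [B bB] := at_least_bounded.
have [m [gm ngm]] : exists m, general (at_least m) /\ ~ general (at_least m.+1).
  have g0 : general (at_least 0).
    apply: general_sub (@generalT K N) => u _.
    by exists [ffun _ => i0], 0; split=> [[]|[]].
  have ngB : ~ general (at_least B.+1).
    move=> gB; have [u [/= bu au]] := general_nonempty (generalI bB gB).
    by have := bu _ au; rewrite ltnn.
  apply: contrapT => nm; apply: ngB; elim: B.+1 => // m gm.
  by apply: contrapT => ngm; apply: nm; exists m.
exists m; have [//|gm'] := at_least_decided m.+1.
have := generalI vertex_not_critical (generalI gm gm').
apply: general_sub => u [nu0 [/at_least_critical[s [us sm su]] nu]].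
rewrite /=; suff -> : critical u = [set` s] by rewrite -sm; exact: card_uniq_seq.
apply/seteqP; split=> w /=; last exact: su.
move=> cw; apply: contrapT => /negP ws; apply: nu.
rewrite -sm; apply: (@critical_at_least u (w :: s)) => //=; first by rewrite ws.
by move=> v; rewrite inE => /predU1P[->//|/su].
Qed.

End CriticalPoints.

(** * Complex-valued continuity and Newton descent *)

Section ComplexContinuity.
Variables (R : realType) (T : topologicalType).
Local Notation K := R[i].

Definition ccontinuous (h : T -> K) :=
  continuous (fun t => complex.Re (h t)) /\ continuous (fun t => complex.Im (h t)).

Lemma ccontinuous_cst a : ccontinuous (fun=> a).
Proof. by split=> t; exact: cvg_cst. Qed.

Lemma ccontinuousD g h : ccontinuous g -> ccontinuous h ->
  ccontinuous (fun t => g t + h t).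
Proof.
move=> [rg ig] [rh ih]; split=> t.
  by under eq_fun do rewrite raddfD; apply: cvgD; [exact: rg|exact: rh].
by under eq_fun do rewrite raddfD; apply: cvgD; [exact: ig|exact: ih].
Qed.

Lemma ccontinuousM g h : ccontinuous g -> ccontinuous h ->
  ccontinuous (fun t => g t * h t).
Proof.
move=> [rg ig] [rh ih].
have E t : g t * h t = Complex
   (complex.Re (g t) * complex.Re (h t) - complex.Im (g t) * complex.Im (h t))
   (complex.Re (g t) * complex.Im (h t) + complex.Im (g t) * complex.Re (h t)).
  by case: (g t) => a b; case: (h t).
split=> t; under eq_fun do rewrite E /=.
  by apply: cvgB; apply: cvgM; [exact: rg|exact: rh|exact: ig|exact: ih].
by apply: cvgD; apply: cvgM; [exact: rg|exact: ih|exact: ig|exact: rh].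
Qed.

Lemma ccontinuous_sum (I : Type) (s : seq I) (P : pred I) (h : I -> T -> K) :
  (forall i, ccontinuous (h i)) -> ccontinuous (fun t => \sum_(i <- s | P i) h i t).
Proof.
move=> hc; elim: s => [|i s IH].
  by under eq_fun do rewrite big_nil; exact: ccontinuous_cst.
under eq_fun do rewrite big_cons; case: (P i) => //.
exact: ccontinuousD.
Qed.

Lemma ccontinuous_prod (I : Type) (s : seq I) (P : pred I) (h : I -> T -> K) :
  (forall i, ccontinuous (h i)) -> ccontinuous (fun t => \prod_(i <- s | P i) h i t).
Proof.
move=> hc; elim: s => [|i s IH].
  by under eq_fun do rewrite big_nil; exact: ccontinuous_cst.
under eq_fun do rewrite big_cons; case: (P i) => //.
exact: ccontinuousM.
Qed.

Lemma ccontinuous_meval n (f : {mpoly K[n]}) (h : 'I_n -> T -> K) :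
  (forall i, ccontinuous (h i)) -> ccontinuous (fun t => f.@[h^~ t]).
Proof.
move=> hc; elim/mpoly_ring_ind: f => [c|i|f g fc gc|f g fc gc].
- by under eq_fun do rewrite mevalC; exact: ccontinuous_cst.
- by under eq_fun do rewrite mevalXU; exact: hc.
- by under eq_fun do rewrite mevalD; exact: ccontinuousD.
- by under eq_fun do rewrite mevalM; exact: ccontinuousM.
Qed.

Lemma ccontinuous_det n (A : T -> 'M[K]_n) :
  (forall i j, ccontinuous (fun t => A t i j)) -> ccontinuous (fun t => \det (A t)).
Proof.
move=> Ac; apply: ccontinuous_sum => s.
apply: ccontinuousM; first exact: ccontinuous_cst.
exact: ccontinuous_prod.
Qed.

Definition sqmod (a : K) : R := complex.Re a ^+ 2 + complex.Im a ^+ 2.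

Lemma sqmod_ge0 a : 0 <= sqmod a.
Proof. by rewrite addr_ge0 ?sqr_ge0. Qed.

Lemma sqmod_eq0 a : (sqmod a == 0) = (a == 0).
Proof. by rewrite paddr_eq0 ?sqr_ge0 // !sqrf_eq0; case: a => x y; rewrite eq_complex. Qed.

Lemma ccontinuous_sqmod h : ccontinuous h -> continuous (fun t => sqmod (h t)).
Proof.
move=> [rh ih] t; rewrite /sqmod; under eq_fun do rewrite !expr2.
by apply: cvgD; apply: cvgM; [exact: rh|exact: rh|exact: ih|exact: ih].
Qed.

End ComplexContinuity.

Section Realification.
Variables (R : realType) (N : nat).
Local Notation K := R[i].

(** Complex vectors are encoded by real ones, to use the compactness of boxes in
    real coordinate spaces. *)
Definition cplx (x : 'rV[R]_(N + N)) : 'rV[K]_N :=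
  \row_l Complex (x 0 (lshift N l)) (x 0 (rshift N l)).

Definition realify (z : 'rV[K]_N) : 'rV[R]_(N + N) :=
  row_mx (\row_l complex.Re (z 0 l)) (\row_l complex.Im (z 0 l)).

Lemma realifyK : cancel realify cplx.
Proof.
move=> z; apply/rowP => l; rewrite mxE row_mxEl row_mxEr !mxE.
by case: (z 0 l).
Qed.

Lemma cplx_inj : injective cplx.
Proof.
move=> x y /rowP xy; apply/rowP => l; case: (splitP l) => k lk; have := xy k.
  have -> : l = lshift N k by exact/val_inj.
  by rewrite !mxE => -[].
have -> : l = rshift N k by exact/val_inj.
by rewrite !mxE => -[].
Qed.

Lemma ccontinuous_cplx l : ccontinuous (fun x => cplx x 0 l).
Proof.
split=> x; under eq_fun do rewrite mxE /=; exact: coord_continuous.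
Qed.

End Realification.

Section Descent.
Variable R : realType.
Local Notation K := R[i].

Lemma poly_decreasing_at0 (p : {poly R}) : p^`().[0] < 0 ->
  exists2 d, 0 < d & forall t, 0 < t < d -> p.[t] < p.[0].
Proof.
move=> p'0.
have [q pq] : exists q, p = q * 'X + (p.[0])%:P.
  have /factor_theorem[q] : root (p - (p.[0])%:P) 0.
    by rewrite /root hornerD hornerN hornerC subrr.
  by rewrite subr0 => E; exists q; rewrite -E subrK.
have q0 : q.[0] < 0.
  move: p'0; rewrite {1}pq derivD derivC addr0 derivM derivX mulr1.
  by rewrite hornerD hornerM hornerX mulr0 add0r.
have /nbhs_ballP[d d0 dq] : \forall t \near (0 : R), q.[t] < 0.
  have /= := @continuous_horner R q 0; move/cvgr_lt; exact.
exists d => // t /andP[t0 td]; rewrite {1}pq !hornerE gtrDr nmulr_rlt0 //.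
by apply: dq; rewrite /ball /= sub0r normrN gtr0_norm.
Qed.

Lemma Re_horner (p : {poly K}) (t : R) :
  (map_poly (@complex.Re R) p).[t] = complex.Re p.[real_complex R t].
Proof.
rewrite (@horner_coef_wide _ (size p)) ?size_poly // horner_coef raddf_sum /=.
apply: eq_bigr => i _; rewrite coef_map -rmorphXn /=.
by case: (p`_i) => a b; rewrite /= mulr0 subr0.
Qed.

Lemma Im_horner (p : {poly K}) (t : R) :
  (map_poly (@complex.Im R) p).[t] = complex.Im p.[real_complex R t].
Proof.
rewrite (@horner_coef_wide _ (size p)) ?size_poly // horner_coef raddf_sum /=.
apply: eq_bigr => i _; rewrite coef_map -rmorphXn /=.
by case: (p`_i) => a b; rewrite /= mulr0 add0r.
Qed.

Lemma deriv_Re (p : {poly K}) :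
  deriv (map_poly (@complex.Re R) p) = map_poly (@complex.Re R) (deriv p).
Proof.
by apply/polyP => i; rewrite coef_deriv !coef_map /= coef_deriv raddfMn.
Qed.

Lemma deriv_Im (p : {poly K}) :
  deriv (map_poly (@complex.Im R) p) = map_poly (@complex.Im R) (deriv p).
Proof.
by apply/polyP => i; rewrite coef_deriv !coef_map /= coef_deriv raddfMn.
Qed.

(** Newton's direction: along [- J^-1 v], where [v] is the current value, the
    squared norm of the value has derivative [-2 * |v| ^ 2]. *)
Lemma newton_descent N (F : 'I_N -> {mpoly K[N]}) (b : 'I_N -> K) (z : 'I_N -> K) :
  \det (jacobian F z) != 0 -> (exists l, (F l).@[z] != b l) ->
  exists h : 'I_N -> K, exists2 d : R, 0 < d & forall t, 0 < t < d ->
    \sum_l sqmod ((F l).@[fun i => z i + real_complex R t * h i] - b l) <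
    \sum_l sqmod ((F l).@[z] - b l).
Proof.
move=> detJ [l0 Fl0]; pose v l := (F l).@[z] - b l.
pose hc := - (invmx (jacobian F z) *m \col_l v l).
have hcE : jacobian F z *m hc = - \col_l v l.
  by rewrite mulmxN mulKVmx // unitmxE unitfE.
pose h i := hc i 0; exists h.
pose A l : {poly K} := along (line z h) (F l) - (b l)%:P.
have AE l t : (A l).[t] = (F l).@[fun i => z i + t * h i] - b l.
  by rewrite hornerD hornerN hornerC along_lineE.
have A0 l : (A l).[0] = v l.
  rewrite AE /v; congr (_ - _); apply: meval_eq => i.
  by rewrite mul0r addr0.
have A'0 l : (A l)^`().[0] = - v l.
  rewrite derivB derivC subr0 deriv_along horner_sum.
  have /colP/(_ l) := hcE; rewrite 3!mxE => <-; apply: eq_bigr => i _.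
  rewrite deriv_line hornerM hornerC mxE along_lineE; congr (_ * _).
  by apply: meval_eq => j; rewrite mul0r addr0.
pose re l := map_poly (@complex.Re R) (A l); pose im l := map_poly (@complex.Im R) (A l).
pose phi : {poly R} := \sum_l (re l ^+ 2 + im l ^+ 2).
have phiE t : phi.[t] = \sum_l sqmod ((F l).@[fun i => z i + real_complex R t * h i] - b l).
  rewrite horner_sum; apply: eq_bigr => l _.
  by rewrite hornerD !horner_exp Re_horner Im_horner AE.
have phi0 : phi.[0] = \sum_l sqmod (v l).
  rewrite phiE; apply: eq_bigr => l _; rewrite -AE rmorph0 A0 //.
have phi'0 : phi^`().[0] = - 2 * \sum_l sqmod (v l).
  rewrite raddf_sum horner_sum mulr_sumr; apply: eq_bigr => l _ /=.
  rewrite derivD !deriv_exp /= !expr1 hornerD !hornerMn !hornerM.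
  rewrite /re /im deriv_Re deriv_Im !Re_horner !Im_horner rmorph0 A0 A'0 /sqmod.
  by rewrite !raddfN /=; ring.
have [|d d0 dphi] := @poly_decreasing_at0 phi.
  rewrite phi'0 mulNr oppr_lt0 mulr_gt0 // (bigD1 l0) //= ltr_pwDl //.
    by rewrite lt_neqAle sqmod_ge0 eq_sym sqmod_eq0 subr_eq0 Fl0.
  by apply: sumr_ge0 => *; exact: sqmod_ge0.
by exists d => // t td; rewrite -phiE -phi0 dphi.
Qed.

End Descent.

(** * Persistence of nondegenerate zeros *)

Lemma nbhs_ray (R : realType) m (x r : 'rV[R]_m) (V : set 'rV[R]_m) :
  nbhs x V -> exists2 e : R, 0 < e & forall t, 0 < t < e -> V (x + t *: r).
Proof.
move=> Vx.
have /nbhs_ballP[e e0 eV] : \forall t \near (0 : R), V (x + t *: r).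
  have cf : (fun t : R => x + t *: r) t @[t --> (0 : R)] --> x + (0 : R) *: r.
    by apply: cvgD; [exact: cvg_cst|apply: cvgZr_tmp; exact: cvg_id].
  by rewrite scale0r addr0 in cf; exact: cf.
exists e => // t /andP[t0 te]; apply: eV.
by rewrite /ball /= sub0r normrN gtr0_norm.
Qed.

Lemma cplx_ray (R : realType) m (x : 'rV[R]_(m + m)) (h : 'I_m -> R[i]) (t : R) l :
  cplx (x + t *: realify (\row_i h i)) 0 l = cplx x 0 l + real_complex R t * h l.
Proof.
have E1 (r : 'rV[R]_(m + m)) j : (x + t *: r) 0 j = x 0 j + t * r 0 j.
  by rewrite !mxE.
rewrite [LHS]mxE !E1 [X in _ = X + _]mxE row_mxEl row_mxEr !mxE.
case: (h l) => u v /=.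
by apply/eqP; rewrite eq_complex /= !mul0r subr0 addr0 !eqxx.
Qed.

Section Persistence.
Variables (R : realType) (T : topologicalType) (N : nat).
Local Notation K := R[i].
Local Notation E := 'rV[R]_(N + N).
Variables (F : T -> 'I_N -> {mpoly K[N]}) (b : T -> 'I_N -> K).

Definition residue (p : T) (x : E) l := (F p l).@[cplx x 0] - b p l.
Definition jacobian_det (p : T) (x : E) := \det (jacobian (F p) (cplx x 0)).

Hypothesis residue_continuous :
  forall l, ccontinuous (fun q : E * T => residue q.2 q.1 l).
Hypothesis jacobian_continuous :
  ccontinuous (fun q : E * T => jacobian_det q.2 q.1).

Definition energy (p : T) (x : E) := \sum_l sqmod (residue p x l).

Lemma energy_ge0 p x : 0 <= energy p x.
Proof. by apply: sumr_ge0 => *; exact: sqmod_ge0. Qed.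

Lemma energy_eq0 p x : energy p x = 0 <-> forall l, residue p x l = 0.
Proof.
split=> [/eqP|r0]; last first.
  by rewrite /energy big1 // => l _; apply/eqP; rewrite sqmod_eq0 r0.
rewrite psumr_eq0 => [/allP h l|*]; last exact: sqmod_ge0.
by have /= := h l (mem_index_enum l); rewrite sqmod_eq0 => /eqP.
Qed.

Lemma energy_continuous : continuous (fun q : E * T => energy q.2 q.1).
Proof.
rewrite /energy; elim: (index_enum _) => [|l s IH] q.
  by under eq_fun do rewrite big_nil; exact: cvg_cst.
under eq_fun do rewrite big_cons.
by apply: cvgD; [exact: ccontinuous_sqmod|exact: IH].
Qed.

Lemma energy_descent p (x : E) (V : set E) : nbhs x V ->
  jacobian_det p x != 0 -> energy p x != 0 ->
  exists2 y, V y & energy p y < energy p x.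
Proof.
move=> Vx Jx ex.
have [h [d d0 hd]] : exists h : 'I_N -> K, exists2 d : R, 0 < d &
    forall t, 0 < t < d -> energy p (x + t *: realify (\row_i h i)) < energy p x.
  have [|h [d d0 hd]] := @newton_descent R N (F p) (b p) (cplx x 0) Jx.
    apply: contrapT => nl; case/eqP: ex; apply/energy_eq0 => l; apply/eqP.
    by rewrite subr_eq0; apply: contraT => hl; case: nl; exists l.
  exists h, d => // t /hd; rewrite /energy /residue; congr (_ < _).
  apply: eq_bigr => l _; congr (sqmod (_ - _)); apply: meval_eq => i.
  by rewrite cplx_ray.
have [e e0 eV] := nbhs_ray (realify (\row_i h i)) Vx.
pose t := Num.min d e / 2.
have m0 : 0 < Num.min d e by rewrite lt_min d0.
have t0 : 0 < t by rewrite divr_gt0.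
have tm : t < Num.min d e by rewrite ltr_pdivrMr // ltr_pMr // ltr1n.
move: tm; rewrite lt_min => /andP[td te].
exists (x + t *: realify (\row_i h i)); last by apply: hd; rewrite t0.
by apply: eV; rewrite t0.
Qed.

Lemma jacobian_near p (x : E) : jacobian_det p x != 0 ->
  \forall q \near (x, p), jacobian_det q.2 q.1 != 0.
Proof.
move=> J0; have sJ := ccontinuous_sqmod jacobian_continuous.
have : 0 < sqmod (jacobian_det p x) by rewrite lt_neqAle sqmod_ge0 eq_sym sqmod_eq0 J0.
move=> /(cvgr_gt _ (sJ (x, p))); apply: filterS => q.
by rewrite lt_neqAle eq_sym sqmod_eq0 => /andP[].
Qed.

Lemma slice p (x : E) (A : set (E * T)) : nbhs (x, p) A -> nbhs x [set y | A (y, p)].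
Proof.
move=> [[U W] /= [Ux Wp] UW]; apply: filterS Ux => y Uy.
by apply: (UW (y, p)); split=> //=; exact: nbhs_singleton.
Qed.

(** The zero [x0] is isolated. So in a small closed box around [x0], for [p] near
    [p0], the Jacobian determinant does not vanish and the energy on the boundary
    exceeds that at [x0]; the minimum of the energy over the box then lies in the
    interior, and Newton's direction leaves it no value but zero. Uniformity in [p] comes from the
    compactness of the box, in its [near_covering] form. *)
Lemma zero_persists p0 (x0 : E) (V : set E) :
  (forall l, residue p0 x0 l = 0) -> jacobian_det p0 x0 != 0 ->
  finite_set [set x | forall l, residue p0 x l = 0] -> nbhs x0 V ->
  \forall p \near p0, exists2 x, V x & forall l, residue p x l = 0.
Proof.
move=> r0 J0 fin Vx0.
pose A := [set x | forall l, residue p0 x l = 0] `\ x0.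
have nA : nbhs x0 (~` A).
  apply: open_nbhs_nbhs; split; last by move=> [_]; apply.
  apply: closed_openC; apply: (iffLR (@accessible_finite_set_closed _)).
    by apply: hausdorff_accessible; exact: norm_hausdorff.
  exact: finite_setD.
have nJ : nbhs x0 [set x | jacobian_det p0 x != 0].
  exact: (slice (jacobian_near J0)).
have [e e0 eV] : exists2 e : R, 0 < e & forall x : E,
    (forall i, `|x0 0 i - x 0 i| <= e) -> [/\ V x, ~ A x & jacobian_det p0 x != 0].
  have : nbhs x0 (V `&` (~` A `&` [set x | jacobian_det p0 x != 0])).
    by apply: filterI => //; apply: filterI.
  move=> /(nbhs_ballP x0) [e e0 eV].
  exists (e / 2) => [|x xe]; first by rewrite divr_gt0.
  have [] : (V `&` (~` A `&` [set x | jacobian_det p0 x != 0])) x.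
    apply: eV; split=> // i j; rewrite /ball /= !ord1.
    by rewrite (le_lt_trans (xe j)) // ltr_pdivrMr // ltr_pMr // ltr1n.
  by move=> ? [].
pose B := [set x : E | forall i, `[x0 0 i - e, x0 0 i + e]%classic (x ord0 i)].
have BP x : B x <-> forall i, `|x0 0 i - x 0 i| <= e.
  split=> Bx i; have := Bx i; rewrite /= in_itv /= distrC ler_distl //.
have cB : compact B 
  by apply: (@rV_compact _ _ (fun i => `[x0 0 i - e, x0 0 i + e]%classic)) => i;
    exact: segment_compact.
have Bx0 : B x0 by apply/BP => i; rewrite subrr normr0 ltW.
pose P p x := jacobian_det p x != 0 /\ (ball x0 e x \/ energy p x0 < energy p x).
have : \forall p \near p0, B `<=` P p.
  apply: (iffLR (compact_near_coveringP _)) cB _ _ _ _ _ => x Bx.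
  have [_ nAx Jx] := eV x (iffLR (BP x) Bx).
  have nP : nbhs (x, p0) [set q | ball x0 e q.1 \/ energy q.2 x0 < energy q.2 q.1].
    have [->|xx0] := eqVneq x x0.
      exists (ball x0 e, setT) => [|[y q] [/= yb _]]; last by left.
      by split=> /=; [exact: nbhsx_ballx|exact: filterT].
    have pos : 0 < energy p0 x - energy p0 x0.
      rewrite (iffRL (energy_eq0 p0 x0) r0) subr0 lt_neqAle energy_ge0 andbT eq_sym.
      apply/eqP => /energy_eq0 rx; apply: nAx; split=> // xE.
      by rewrite xE eqxx in xx0.
    have cD : (fun q : E * T => energy q.2 q.1 - energy q.2 x0) q @[q --> (x, p0)]
        --> energy p0 x - energy p0 x0.
      apply: cvgB; first exact: energy_continuous (x, p0).
      apply: (@continuous_comp _ _ _ (fun q : E * T => (x0, q.2))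
        (fun q => energy q.2 q.1) (x, p0)); last exact: energy_continuous.
      move=> D [[U W] /= [Ux Wp] UW]; exists (setT, W).
        by split=> //=; exact: filterT.
      by move=> [y q] [/= _ Wq]; apply: (UW (x0, q)); split=> //; exact: nbhs_singleton.
    move: pos => /(cvgr_gt _ cD); apply: filterS => q.
    by rewrite subr_gt0; right.
  exact: filterI (jacobian_near Jx) nP.
apply: filterS => p BPp.
have cE : {within B, continuous (energy p)}.
  apply: continuous_subspaceT => y.
  apply: (@continuous_comp _ _ _ (fun y : E => (y, p)) (fun q => energy q.2 q.1)).
    by move=> D; exact: slice.
  exact: energy_continuous.
have [c] := @compact_EVT_min E R (energy p) B (ex_intro _ x0 Bx0) cB cE.
rewrite inE => Bc minc; exists c; first by have [] := eV c (iffLR (BP c) Bc).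
apply/energy_eq0; apply/eqP; apply: contraT => ec.
have [Jc [bc|]] := BPp _ Bc; last by rewrite ltNge minc // inE.
have nc : nbhs c (ball x0 e) by apply: open_nbhs_nbhs; split => //; exact: ball_open.
have [y by_] := energy_descent nc Jc ec.
rewrite ltNge minc // inE; apply/BP => i.
by have [_ /(_ 0 i)] := by_; rewrite /ball /= => /ltW.
Qed.

End Persistence.

(** * The charts of the Segre-Veronese cone *)

Section SegreVeroneseCharts.
Variables (R : realType) (k : nat) (n d : 'I_k -> nat).
Hypothesis d_gt0 : forall i, (0 < d i)%N.
Local Notation K := R[i].
Local Notation N := (dimSd n d).
Local Notation C := (affine_cone (segre_veronese R n d)).

Local Notation T := {i : 'I_k & 'I_(n i).+1}.
Local Notation mkT j := (Tagged (fun i => 'I_(n i).+1) j).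

Definition degree_in (l : 'I_N) (t : T) : nat :=
  val (enum_val l (tag t)) (tagged t).

Definition entry (x : forall i, 'rV[K]_(n i).+1) (t : T) : K :=
  x (tag t) 0 (tagged t).

Lemma power_tensorE x l :
  power_tensor n d x 0 l = \prod_t entry x t ^+ degree_in l t.
Proof.
rewrite mxE (sig_big_dep (fun=> true) (fun _ _ => true)
  (fun i (j : 'I_(n i).+1) => x i 0 j ^+ val (enum_val l i) j)) /=.
by apply: eq_bigl.
Qed.

Lemma sum_over_tag (f : T -> nat) i :
  (\sum_(t | tag t == i) f t = \sum_(j < (n i).+1) f (mkT j))%N.
Proof.
rewrite -(big_pred1_eq addn i
  (fun i => \sum_(j < (n i).+1) f (mkT j))%N).
rewrite (sig_big_dep (fun i' => i' == i) (fun _ _ => true)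
  (fun i (j : 'I_(n i).+1) => f (mkT j))) /=.
by apply: eq_big => [t|[]//]; rewrite andbT.
Qed.

Lemma sum_degree_in l i : (\sum_(t | tag t == i) degree_in l t = d i)%N.
Proof. by rewrite sum_over_tag; apply/eqP/(valP (enum_val l i)). Qed.

Lemma degree_in_onto (f : T -> nat) :
  (forall i, \sum_(t | tag t == i) f t = d i)%N ->
  exists l, forall t, degree_in l t = f t.
Proof.
move=> fd.
have fle t : (f t < (d (tag t)).+1)%N by rewrite ltnS -fd (bigD1 t) //= leq_addr.
pose g i : {ffun 'I_(n i).+1 -> 'I_(d i).+1} := [ffun j => inord (f (mkT j))].
have gP i : (\sum_(j < (n i).+1) (g i j : nat) == d i)%N.
  apply/eqP; rewrite -[RHS]fd sum_over_tag; apply: eq_bigr => j _.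
  by rewrite ffunE inordK // (fle (mkT j)).
pose a : multiexponent n d := [ffun i => exist _ (g i) (gP i)].
exists (enum_rank a) => -[i j].
by rewrite /degree_in enum_rankK ffunE /= ffunE inordK // (fle (mkT j)).
Qed.

Section Anchored.
Variable q : {dffun forall i : 'I_k, 'I_(n i).+1}.

(** In the chart of [q], the coordinate of number [q i] of each [x_i] is not zero. *)
Definition anchor (i : 'I_k) : T := mkT (q i).

Lemma sum_anchor (f : 'I_k -> nat) i :
  (\sum_(t | tag t == i) (if t == anchor (tag t) then f (tag t) else 0) = f i)%N.
Proof.
rewrite (bigD1 (anchor i)) //= eqxx big1 ?addn0 // => t /andP[/eqP ti ta].
by rewrite ti (negPf ta).
Qed.

Lemma pole_exists : exists l, forall t,
  degree_in l t = if t == anchor (tag t) then d (tag t) else 0%N.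
Proof. by apply: degree_in_onto => i; exact: sum_anchor. Qed.

(** The coordinate whose entry is the product of the [x_(i, q i) ^ d i]. *)
Definition sv_pole := projT1 (cid pole_exists).

Lemma degree_pole t :
  degree_in sv_pole t = if t == anchor (tag t) then d (tag t) else 0%N.
Proof. exact: projT2 (cid pole_exists) t. Qed.

Lemma base_exists (s : T) : exists l, forall t, (degree_in l t =
  (if t == anchor (tag t) then d (tag t) - (tag t == tag s) else 0) + (t == s))%N.
Proof.
apply: degree_in_onto => i; rewrite big_split /=.
rewrite (sum_anchor (fun j => d j - (j == tag s))%N).
suff -> : (\sum_(t | tag t == i) (t == s) = (i == tag s))%N.
  by rewrite subnK // (leq_trans (leq_b1 _)).
have [->|ni] := eqVneq i (tag s).
  by rewrite (bigD1 s) //= eqxx big1 // => t /andP[_ /negPf->].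
by rewrite big1 // => t /eqP ti; case: eqP => // ts; rewrite -ti ts eqxx in ni.
Qed.

(** The coordinate whose entry is that of the pole with one factor [x_(i, q i)]
    replaced by [x_s], where [i] is the tag of [s]. *)
Definition sv_index (s : T) := projT1 (cid (base_exists s)).

Lemma degree_index s t : (degree_in (sv_index s) t =
  (if t == anchor (tag t) then d (tag t) - (tag t == tag s) else 0) + (t == s))%N.
Proof. exact: projT2 (cid (base_exists s)) t. Qed.

Definition nonanchor (t : T) := t != anchor (tag t).

Definition sv_base : {set 'I_N} := [set sv_index t | t in nonanchor].

Definition sv_expo (l : 'I_N) : 'X_{1.. N} :=
  (\sum_(t | nonanchor t) U_(sv_index t) *+ degree_in l t)%MM.

Lemma sv_monomialE l (z : 'rV[K]_N) :
  monomial_at (sv_expo l) z = \prod_(t | nonanchor t) z 0 (sv_index t) ^+ degree_in l t.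
Proof.
rewrite /monomial_at /peval /sv_expo -mprodXnE rmorph_prod /=.
by apply: eq_bigr => t _; rewrite rmorphXn /= mevalXU.
Qed.

Lemma degree_index_free s t : nonanchor t -> degree_in (sv_index s) t = (t == s).
Proof. by move=> /negPf ft; rewrite degree_index ft. Qed.

Lemma sv_expo_pole : sv_expo sv_pole = 0%MM.
Proof.
by rewrite /sv_expo big1 // => t /negPf ft; rewrite degree_pole ft mulm0n.
Qed.

Lemma sv_expo_base l : l \in sv_base -> sv_expo l = U_(l)%MM.
Proof.
case/imsetP => s fs ->; rewrite /sv_expo (bigD1 s) //= big1 => [|t /andP[ft ts]].
  by rewrite degree_index_free // eqxx mulm1n addm0.
by rewrite degree_index_free // (negPf ts) mulm0n.
Qed.

Lemma sv_expo_support l r : r \notin sv_base -> sv_expo l r = 0%N.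
Proof.
move=> rS; rewrite /sv_expo mnm_sumE big1 // => t ft; rewrite mulmnE mnm1E.
case: eqP => [tr|_]; last by rewrite mul0n.
by case/negP: rS; rewrite -tr; apply: imset_f.
Qed.

Lemma sv_index_pole t : nonanchor t -> sv_index t != sv_pole.
Proof.
move=> ft; apply/eqP => /(congr1 (degree_in^~ t)).
by rewrite degree_index_free // eqxx degree_pole (negPf ft).
Qed.

Lemma pole_entry x :
  power_tensor n d x 0 sv_pole = \prod_i entry x (anchor i) ^+ d i.
Proof.
rewrite power_tensorE (partition_big (@tag _ _) predT) //=; apply: eq_bigr => i _.
rewrite (bigD1 (anchor i)) //= degree_pole eqxx big1 ?mulr1 // => t.
by move=> /andP[/eqP ti ta]; rewrite degree_pole ti (negPf ta).
Qed.

(** Both sides are homogeneous of degree [d i] in each [x_i], so the [x_i] may be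
    normalised by their anchor coordinates. *)
Lemma power_tensor_ratio x l : (forall i, entry x (anchor i) != 0) ->
  power_tensor n d x 0 l = power_tensor n d x 0 sv_pole *
    \prod_(t | nonanchor t) (entry x t / entry x (anchor (tag t))) ^+ degree_in l t.
Proof.
move=> xN0; rewrite pole_entry.
have -> : \prod_i entry x (anchor i) ^+ d i =
    \prod_t entry x (anchor (tag t)) ^+ degree_in l t.
  rewrite [RHS](partition_big (@tag _ _) predT) //=; apply: eq_bigr => i _.
  rewrite -(sum_degree_in l i) -prodrXr; apply: eq_bigr => t /eqP ti.
  by rewrite ti.
rewrite [X in _ * X]big_mkcond -big_split power_tensorE /=; apply: eq_bigr => t _.
rewrite /nonanchor; case: eqP => [<-|_]; first by rewrite mulr1.
by rewrite expr_div_n mulrC divfK // expf_neq0.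
Qed.

Lemma sv_chart_in (z : 'rV[K]_N) : z 0 sv_pole != 0 ->
  C (\row_l (z 0 sv_pole * monomial_at (sv_expo l) z)).
Proof.
move=> z0; right; exists (z 0 sv_pole).
pose Y (t : T) := if nonanchor t then z 0 (sv_index t) else 1.
exists (fun i => \row_j Y (mkT j)); split=> // [i|].
  apply: contra_neq (oner_neq0 K) => /rowP/(_ (q i)).
  by rewrite !mxE /Y /nonanchor eqxx.
apply/rowP => l; rewrite [LHS]mxE [RHS]mxE power_tensorE sv_monomialE; congr (_ * _).
rewrite big_mkcond; apply: eq_bigr => -[i j] _.
by rewrite /entry mxE /Y /=; case: ifP; rewrite ?expr1n.
Qed.

Lemma entry_neq0 c x : (c *: power_tensor n d x) 0 sv_pole != 0 ->
  forall i, entry x (anchor i) != 0.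
Proof.
rewrite mxE mulf_eq0 negb_or pole_entry => /andP[_ /prodf_neq0 h] i.
by have := h i isT; rewrite expf_eq0 d_gt0.
Qed.

Lemma sv_chart_onto (w : 'rV[K]_N) : C w -> w 0 sv_pole != 0 ->
  exists z : 'rV[K]_N, w = \row_l (z 0 sv_pole * monomial_at (sv_expo l) z).
Proof.
move=> [->|[c [x [cN0 xN0 ->]]]]; first by rewrite mxE eqxx.
set w' := _ *: _ => w0; have aN0 := entry_neq0 w0.
have wE l : w' 0 l = w' 0 sv_pole *
    \prod_(t | nonanchor t) (entry x t / entry x (anchor (tag t))) ^+ degree_in l t.
  by rewrite /w' mxE [in RHS]mxE -mulrA -power_tensor_ratio.
pose z : 'rV[K]_N :=
  \row_l if l == sv_pole then w' 0 sv_pole else w' 0 l / w' 0 sv_pole.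
have z0 : z 0 sv_pole = w' 0 sv_pole by rewrite mxE eqxx.
exists z; apply/rowP => l; rewrite [RHS]mxE z0 [LHS]wE sv_monomialE; congr (_ * _).
apply: eq_bigr => t ft; rewrite [z _ _]mxE (negPf (sv_index_pole ft)) (wE (sv_index t)).
rewrite mulrAC divff // mul1r (bigD1 t) //= degree_index_free // eqxx big1 ?mulr1 //.
by move=> s /andP[fs st]; rewrite degree_index_free // (negPf st).
Qed.

(** Each point of the cone is the value at 0 of a polynomial curve that meets the
    zero set of the pole coordinate finitely often: add [s] to the anchor
    coordinates of the [x_i] or, for the vertex, multiply by [s] the point whose
    coordinates are all 1. *)
Lemma sv_chart_dense (f : {mpoly K[N]}) :
  (forall w, C w -> w 0 sv_pole != 0 -> peval f w = 0) ->
  forall w, C w -> peval f w = 0.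
Proof.
move=> f0 w Cw.
have [h [g [gN0 hw hg]]] : exists (h : 'I_N -> {poly K}) (g : {poly K}), [/\ g != 0,
    forall l, (h l).[0] = w 0 l & forall s, g.[s] != 0 ->
    C (\row_l (h l).[s]) /\ (h sv_pole).[s] != 0].
  case: Cw => [->|[c [x [cN0 xN0 ->]]]].
    pose x1 i : 'rV[K]_(n i).+1 := const_mx 1.
    have p1 l : power_tensor n d x1 0 l = 1.
      by rewrite power_tensorE big1 // => t _; rewrite /entry mxE expr1n.
    exists (fun=> 'X), 'X; split=> [|l|s]; rewrite ?polyX_eq0 ?hornerX ?mxE // => sN0.
    split; rewrite ?hornerX //; right; exists s, x1; split=> // [i|].
      by apply: contra_neq (oner_neq0 K) => /rowP/(_ 0); rewrite !mxE.
    by apply/rowP => l; rewrite [LHS]mxE [RHS]mxE p1 mulr1.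
  pose X (t : T) : {poly K} := (entry x t)%:P + (if nonanchor t then 0 else 'X).
  exists (fun l => c%:P * \prod_t X t ^+ degree_in l t).
  exists (\prod_i X (anchor i)); split=> [|l|s].
  - apply/prodf_neq0 => i _; rewrite /X /nonanchor eqxx addrC.
    by apply/eqP => /(congr1 (size \o val)) /=; rewrite size_XaddC size_poly0.
  - rewrite hornerM hornerC horner_prod mxE power_tensorE; congr (_ * _).
    apply: eq_bigr => t _; rewrite horner_exp /X hornerD hornerC.
    by case: (nonanchor t); rewrite ?hornerX ?hornerC ?horner0 addr0.
  rewrite horner_prod => /prodf_neq0 XN0.
  pose y i : 'rV[K]_(n i).+1 := \row_j (X (mkT j)).[s].
  have hy l : (c%:P * \prod_t X t ^+ degree_in l t).[s] =
      (c *: power_tensor n d y) 0 l.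
    rewrite hornerM hornerC horner_prod mxE power_tensorE; congr (_ * _).
    by apply: eq_bigr => -[i j] _; rewrite horner_exp /entry mxE.
  split.
    right; exists c, y; split=> // [i|].
      apply: contra_neq (XN0 i isT) => /rowP/(_ (q i)).
      by rewrite !mxE => ->.
    by apply/rowP => l; rewrite mxE hy.
  rewrite hy mxE mulf_neq0 // pole_entry; apply/prodf_neq0 => i _.
  by rewrite expf_neq0 // /entry mxE XN0.
have fh0 : along h f = 0.
  apply: (poly_eq0_cofinite gN0) => s /hg[Ch hN0]; rewrite horner_along.
  rewrite (meval_eq (v2 := (\row_l (h l).[s]) 0)) => [|l]; last by rewrite mxE.
  by apply: f0 => //; rewrite mxE.
have := congr1 (horner^~ 0) fh0; rewrite horner_along horner0 => <-.
by apply: meval_eq => l; rewrite hw.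
Qed.

Definition sv_chart : toric_chart C :=
  ToricChart sv_expo_pole sv_expo_base sv_expo_support sv_chart_in
    sv_chart_onto sv_chart_dense.

End Anchored.

Lemma sv_charts_cover w : C w -> w != 0 -> exists q, w 0 (pole (sv_chart q)) != 0.
Proof.
move=> [->|[c [x [cN0 xN0 ->]]] _]; first by rewrite eqxx.
have xq i : {j | x i 0 j != 0} by apply: cid; apply/rV0Pn.
exists [ffun i => projT1 (xq i)]; rewrite mxE mulf_neq0 // pole_entry.
by apply/prodf_neq0 => i _; rewrite expf_neq0 // /entry /= ffunE (projT2 (xq i)).
Qed.

End SegreVeroneseCharts.

(** * Lower semicontinuity of the ED degree *)

Section Semicontinuity.
Variables (R : realType) (N : nat).
Local Notation K := R[i].
Local Notation E := 'rV[R]_(N + N).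
Local Notation complexify Q := (map_mx (real_complex R) Q).

Lemma inner_product_unit (Q : 'M[R]_N) : inner_product Q -> complexify Q \in unitmx.
Proof.
move=> [_ posQ]; rewrite map_unitmx -row_free_unit -kermx_eq0.
apply: contraT => /rowV0Pn[v /sub_kermxP vQ vN0].
by have := posQ v vN0; rewrite /bform vQ mul0mx mxE ltxx.
Qed.

(** The line from [x] to a point where [g] does not vanish contains only finitely
    many zeros of [g]. *)
Lemma general_dense (P : set 'rV[K]_N) (x : E) (B : set E) :
  general P -> nbhs x B -> exists2 y, B y & P (cplx y).
Proof.
move=> [g gN0 gP] Bx; have [v gv] := mpoly_neq0_meval gN0.
pose h l := v l - cplx x 0 l.
have [e e0 eB] := nbhs_ray (realify (\row_i h i)) Bx.
pose p := along (line (cplx x 0) h) g.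
have pE t : p.[real_complex R t] = peval g (cplx (x + t *: realify (\row_i h i))).
  by rewrite along_lineE; apply: meval_eq => l; rewrite cplx_ray.
have pN0 : p != 0.
  apply: contra_neq gv => p0; have := congr1 (horner^~ 1) p0.
  rewrite horner0 along_lineE => E0; rewrite -[RHS]E0; apply: meval_eq => l.
  by rewrite mul1r /h addrC subrK.
pose t j : R := e / j.+2%:R.
have [j pj] : exists j, p.[real_complex R (t j)] != 0.
  apply: contrapT => /forallNP nj.
  have := @max_poly_roots _ p [seq real_complex R (t j) | j <- iota 0 (size p)] pN0.
  rewrite size_map size_iota ltnn => nroots; apply: notF; apply: nroots.
    by apply/allP => _ /mapP[j _ ->]; apply/negPn/negP => /nj.
  rewrite map_inj_uniq ?iota_uniq // => j j' /(congr1 (@complex.Re R)) /= /eqP.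
  rewrite (inj_eq (mulfI (lt0r_neq0 e0))) (inj_eq invr_inj) eqr_nat.
  by move=> /eqP[].
exists (x + t j *: realify (\row_i h i)).
  apply: eB; rewrite divr_gt0 //= ltr_pdivrMr // ltr_pMr // ltr1n //.
by apply: gP; rewrite -pE.
Qed.

Lemma bounded_fibre_finite (A : set 'rV[K]_N) e :
  (forall s : seq 'rV[K]_N, uniq s -> (forall z, z \in s -> A z) -> (size s <= e)%N) ->
  finite_set [set x : E | A (cplx x)].
Proof.
move=> eA; apply: contrapT => /(@infinite_set_fset _ _ e.+1)[B BA eB].
have := eA [seq cplx x | x <- enum_fset B].
rewrite size_map leqNgt eB => nB; apply: notF; apply: nB.
  by rewrite map_inj_uniq ?fset_uniq //; exact: cplx_inj.
by move=> z /mapP[x xB ->]; exact: BA.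
Qed.

Lemma card_II_seq (T : choiceType) (A : set T) m : A #= `I_m ->
  exists s : seq T, [/\ uniq s, size s = m & forall w, w \in s -> A w].
Proof.
move=> Am; have fA : finite_set A by apply/finite_setP; exists m.
exists (enum_fset (fset_set A)); split; first exact: fset_uniq.
  exact: card_fset_set.
by move=> w; rewrite [w \in _]in_fset_set // => /set_mem.
Qed.

Section Chart.
Variables (C : set 'rV[K]_N) (c : toric_chart C).

Lemma ccontinuous_chart (T : topologicalType) (z : T -> 'rV[K]_N) l :
  (forall i, ccontinuous (fun t => z t 0 i)) ->
  ccontinuous (fun t => chart c (z t) 0 l).
Proof.
move=> zc.
have -> : (fun t => chart c (z t) 0 l) =
    fun t => ('X_(pole c) * 'X_[expo c l] : {mpoly K[N]}).@[(fun i s => z s 0 i)^~ t].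
  by apply/funext => t; rewrite mxE mevalM mevalXU.
exact: ccontinuous_meval.
Qed.

(** The system [ed_map Q z = u *m Q] as a family with parameter [p = (Q, u)]. *)
Definition ed_family (p : 'M[R]_N * E) := ed_map c (complexify p.1).
Definition ed_target (p : 'M[R]_N * E) l := (cplx p.2 *m complexify p.1) 0 l.
Let F := ed_family.
Let b := ed_target.

Let Qc i j : ccontinuous (fun q : E * ('M[R]_N * E) => complexify q.2.1 i j).
Proof.
split=> q; under eq_fun do rewrite mxE /=; last exact: cvg_cst.
apply: (@continuous_comp _ _ _ (fun q : E * ('M[R]_N * E) => q.2.1)
  (fun A : 'M[R]_N => A i j)); last exact: coord_continuous.
apply: (@continuous_comp _ _ _ (fun q : E * ('M[R]_N * E) => q.2) fst).
  exact: cvg_snd.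
exact: cvg_fst.
Qed.

Let zc i : ccontinuous (fun q : E * ('M[R]_N * E) => cplx q.1 0 i).
Proof.
have [rc ic] := @ccontinuous_cplx R N i.
by split=> q; [apply: (@continuous_comp _ _ _ fst _ q _ (rc _))|
  apply: (@continuous_comp _ _ _ fst _ q _ (ic _))]; exact: cvg_fst.
Qed.

Let uc i : ccontinuous (fun q : E * ('M[R]_N * E) => cplx q.2.2 0 i).
Proof.
have [rc ic] := @ccontinuous_cplx R N i.
have c22 : continuous (fun q : E * ('M[R]_N * E) => q.2.2).
  move=> q; apply: (@continuous_comp _ _ _ (fun q : E * ('M[R]_N * E) => q.2) snd).
    exact: cvg_snd.
  exact: cvg_snd.
by split=> q; [apply: (continuous_comp (c22 q) (rc _))|
  apply: (continuous_comp (c22 q) (ic _))].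
Qed.

Lemma ed_residue_continuous l :
  ccontinuous (fun q : E * ('M[R]_N * E) => residue F b q.2 q.1 l).
Proof.
have -> : (fun q : E * ('M[R]_N * E) => residue F b q.2 q.1 l) = fun q =>
    \sum_r chart c (cplx q.1) 0 r * complexify q.2.1 r l
    + (conormal c l).@[(fun i s => cplx s.1 0 i)^~ q]
    + -1 * \sum_r cplx q.2.2 0 r * complexify q.2.1 r l.
  apply/funext => q; rewrite /residue -[X in X - _]/(peval _ _) peval_ed_map.
  by rewrite /b /ed_target !mxE mulN1r.
apply: ccontinuousD; first apply: ccontinuousD.
- apply: ccontinuous_sum => r; apply: ccontinuousM => //.
  exact: ccontinuous_chart.
- exact: ccontinuous_meval.
- apply: ccontinuousM; first exact: ccontinuous_cst.
  by apply: ccontinuous_sum => r; apply: ccontinuousM.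
Qed.

Lemma ed_jacobian_continuous :
  ccontinuous (fun q : E * ('M[R]_N * E) => jacobian_det F q.2 q.1).
Proof.
apply: ccontinuous_det => l j.
have -> : (fun q : E * ('M[R]_N * E) => jacobian (F q.2) (cplx q.1 0) l j) = fun q =>
    \sum_r complexify q.2.1 r l *
       ('X_(pole c) * 'X_[expo c r] : {mpoly K[N]})^`M(j).@[(fun i s => cplx s.1 0 i)^~ q]
    + (conormal c l)^`M(j).@[(fun i s => cplx s.1 0 i)^~ q].
  apply/funext => q; rewrite mxE /F /ed_family /ed_map mulr_sumr mderivD mevalD; congr (_ + _).
  rewrite (raddf_sum (mderiv j)) (raddf_sum (meval _)) /=; apply: eq_bigr => r _.
  by rewrite -scalerAr mderivZ mevalZ.
apply: ccontinuousD; last exact: ccontinuous_meval.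
apply: ccontinuous_sum => r; apply: ccontinuousM => //; exact: ccontinuous_meval.
Qed.

End Chart.

Section Atlas.
Variables (X : set 'rV[K]_N) (I : finType) (cs : I -> toric_chart (affine_cone X)).
Variable i0 : I.
Hypothesis cover :
  forall w, affine_cone X w -> w != 0 -> exists i, w 0 (pole (cs i)) != 0.

Lemma EDdegree_general (Q : 'M[R]_N) : inner_product Q ->
  general (fun u => critical_points Q X u #= `I_(EDdegree Q X)).
Proof.
move=> /inner_product_unit Qu; have [m gm] := general_critical_count i0 cover Qu.
exact: (@xgetPex _ 0%N
  [set m | general (fun u => critical_points Q X u #= `I_m)] (ex_intro _ m gm)).
Qed.

(** The hypotheses of [zero_persists] hold over general data. *)
Lemma general_nondegenerate (Q : 'M[R]_N) (i : I) : inner_product Q ->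
  general [set u | finite_set [set x : E | forall l,
        (ed_map (cs i) (complexify Q) l).@[cplx x 0] = (u *m complexify Q) 0 l] /\
    forall z : 'rV[K]_N,
      (forall l, (ed_map (cs i) (complexify Q) l).@[z 0] = (u *m complexify Q) 0 l) ->
      \det (jacobian (ed_map (cs i) (complexify Q)) (z 0)) != 0].
Proof.
move=> /inner_product_unit Qu.
have [g gN0 gJ] := generic_jacobian (ed_map (cs i) (complexify Q)).
have [h hN0 [e he]] := generic_fibre_bounded (ed_map (cs i) (complexify Q)).
have := generalI (general_mulmx Qu gN0) (general_mulmx Qu hN0).
apply: general_sub => u [/= gu hu]; split.
  apply: (@bounded_fibre_finite [set z | forall l,
    (ed_map (cs i) (complexify Q) l).@[z 0] = (u *m complexify Q) 0 l] e) => s us su.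
  exact: (he _ s hu us su).
move=> z uz; apply: gJ; rewrite (meval_eq (v2 := (u *m complexify Q) 0)) //.
Qed.

(** Distinct critical points stay distinct when they move a little. *)
Lemma separate_images (c1 c2 : toric_chart (affine_cone X)) (x1 x2 : E) :
  chart c1 (cplx x1) <> chart c2 (cplx x2) ->
  exists V : set E * set E, [/\ nbhs x1 V.1, nbhs x2 V.2 &
    forall y1 y2, V.1 y1 -> V.2 y2 -> chart c1 (cplx y1) <> chart c2 (cplx y2)].
Proof.
move=> x12.
have [l xl] : exists l, chart c1 (cplx x1) 0 l != chart c2 (cplx x2) 0 l.
  apply: contrapT => nl; apply: x12; apply/rowP => l; apply/eqP.
  by apply: contraT => xl; case: nl; exists l.
pose D (q : E * E) := chart c1 (cplx q.1) 0 l + -1 * chart c2 (cplx q.2) 0 l.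
have Dc : ccontinuous D.
  apply: ccontinuousD; last apply: ccontinuousM; first 1 last.
  - exact: ccontinuous_cst.
  - apply: ccontinuous_chart => j; have [rc ic] := @ccontinuous_cplx R N j.
    split=> q; [apply: (@continuous_comp _ _ _ snd _ q _ (rc _))|
      apply: (@continuous_comp _ _ _ snd _ q _ (ic _))]; exact: cvg_snd.
  - apply: ccontinuous_chart => j; have [rc ic] := @ccontinuous_cplx R N j.
    split=> q; [apply: (@continuous_comp _ _ _ fst _ q _ (rc _))|
      apply: (@continuous_comp _ _ _ fst _ q _ (ic _))]; exact: cvg_fst.
have : 0 < sqmod (D (x1, x2)).
  by rewrite lt_neqAle sqmod_ge0 eq_sym sqmod_eq0 /D /= mulN1r subr_eq0 xl.
have sD := ccontinuous_sqmod Dc.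
move=> /(cvgr_gt _ (sD (x1, x2))) [V [V1 V2] VD].
exists V; split=> // y1 y2 Vy1 Vy2 E12; have := VD (y1, y2) (conj Vy1 Vy2).
by rewrite /= /D /= E12 mulN1r subrr /sqmod /= expr0n addr0 ltxx.
Qed.

(** Each of the [m] points persists inside a neighbourhood [U a] where its pole
    coordinate does not vanish and whose image is disjoint from that of the other
    [U b]. *)
Lemma at_least_persists (Q : 'M[R]_N) (u : E) m :
  (forall i, finite_set [set x : E | forall l,
        (ed_map (cs i) (complexify Q) l).@[cplx x 0] = (cplx u *m complexify Q) 0 l] /\
    forall z : 'rV[K]_N,
      (forall l, (ed_map (cs i) (complexify Q) l).@[z 0] = (cplx u *m complexify Q) 0 l) ->
      \det (jacobian (ed_map (cs i) (complexify Q)) (z 0)) != 0) ->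
  at_least cs (complexify Q) m (cplx u) ->
  \forall p \near (Q, u), at_least cs (complexify p.1) m (cplx p.2).
Proof.
move=> nondeg [k [z [uz zz]]].
pose x a := realify (row a z).
have xE a : cplx (x a) = row a z by exact: realifyK.
have /choice[V VP] : forall ab : 'I_m * 'I_m, exists V : set E * set E,
    ab.1 != ab.2 -> [/\ nbhs (x ab.1) V.1, nbhs (x ab.2) V.2 & forall y1 y2,
      V.1 y1 -> V.2 y2 -> chart (cs (k ab.1)) (cplx y1) <> chart (cs (k ab.2)) (cplx y2)].
  move=> [a b] /=; have [->|ab] := eqVneq a b; first by exists (setT, setT).
  have := @separate_images (cs (k a)) (cs (k b)) (x a) (x b); rewrite !xE.
  by move=> /(_ (zz a b ab))[W WP]; exists W.
pose U a := [set y : E | [/\ cplx y 0 (pole (cs (k a))) != 0,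
  forall b, a != b -> (V (a, b)).1 y & forall b, b != a -> (V (b, a)).2 y]].
have nU a : nbhs (x a) (U a).
  have n1 : nbhs (x a) [set y : E | cplx y 0 (pole (cs (k a))) != 0].
    have sc := ccontinuous_sqmod (@ccontinuous_cplx R N (pole (cs (k a)))).
    have : 0 < sqmod (cplx (x a) 0 (pole (cs (k a)))).
      by rewrite lt_neqAle sqmod_ge0 eq_sym sqmod_eq0 xE (proj1 (uz a)).
    move=> /(cvgr_gt _ (sc (x a))); apply: filterS => y.
    by rewrite lt_neqAle eq_sym sqmod_eq0 => /andP[].
  have n2 : nbhs (x a) [set y : E | forall b, a != b -> (V (a, b)).1 y].
    apply: (@filter_forall _ _ (fun b y => a != b -> (V (a, b)).1 y)
      _ (nbhs_filter (x a))) => b.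
    have [->|ab] := eqVneq a b; first exact: nearW.
    by have [] := VP (a, b) ab => n2 _ _; apply: filterS n2 => y.
  have n3 : nbhs (x a) [set y : E | forall b, b != a -> (V (b, a)).2 y].
    apply: (@filter_forall _ _ (fun b y => b != a -> (V (b, a)).2 y)
      _ (nbhs_filter (x a))) => b.
    have [->|ba] := eqVneq b a; first exact: nearW.
    by have [] := VP (b, a) ba => _ n3 _; apply: filterS n3 => y.
  by apply: filterS (filterI n1 (filterI n2 n3)) => y [? []].
have zper a : \forall p \near (Q, u), exists2 y, U a y &
    forall l, residue (ed_family (cs (k a))) ed_target p y l = 0.
  have [fin Jac] := nondeg (k a).
  have Uz l : (ed_map (cs (k a)) (complexify Q) l).@[cplx (x a) 0] =
     (cplx u *m complexify Q) 0 l by rewrite xE -(proj2 (uz a)).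
  apply: (@zero_persists _ _ _ _ _ _ _ (Q, u) (x a)).
  - exact: ed_residue_continuous.
  - exact: ed_jacobian_continuous.
  - by move=> l; apply/eqP; rewrite subr_eq0; apply/eqP/Uz.
  - exact: Jac.
  - congr finite_set: fin; apply/seteqP; split=> y yP l.
      by apply/eqP; rewrite subr_eq0; apply/eqP/yP.
    by apply/eqP; rewrite -subr_eq0; apply/eqP/yP.
  - exact: nU.
have : \forall p \near (Q, u), forall a, exists2 y, U a y &
    forall l, residue (ed_family (cs (k a))) ed_target p y l = 0.
  exact: (@filter_forall _ _ _ _ (nbhs_filter (Q, u)) zper).
apply: filterS => p py.
have /choice[y yP] : forall a, exists y, U a y /\
    forall l, residue (ed_family (cs (k a))) ed_target p y l = 0.
  by move=> a; have [y Uy ry] := py a; exists y.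
exists k, (\matrix_a cplx (y a)); split=> [a|a b ab]; rewrite !rowK.
  have [[y0 _ _] ry] := yP a; split=> // l.
  by apply/eqP; rewrite -subr_eq0; apply/eqP/ry.
have [_ _ Wab] := VP (a, b) ab.
have [[_ Va _] _] := yP a; have [[_ _ Vb] _] := yP b.
by apply: Wab; [exact: Va|exact: Vb].
Qed.

(** Data [u] general for [QF] have at least [m] critical points for all [(Q, y)]
    near [(QF, u)], and some of these [y] are general for [Q]. *)
Theorem EDdegree_lower_semicontinuous (QF : 'M[R]_N) : inner_product QF ->
  \forall Q \near QF, inner_product Q -> (EDdegree QF X <= EDdegree Q X)%N.
Proof.
move=> ipF; have QFu := inner_product_unit ipF.
have gF := EDdegree_general ipF; set m := EDdegree QF X in gF *.
have := generalI gF (generalI (vertex_not_critical cs i0 QFu)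
  (general_forall (fun i => general_nondegenerate i ipF))).
move=> /general_nonempty[u [cu [/= nu0 nondeg]]].
have [s [us sm su]] := card_II_seq cu.
have am : at_least cs (complexify QF) m u.
  by rewrite -sm; apply: critical_at_least.
have : \forall p \near (QF, realify u), at_least cs (complexify p.1) m (cplx p.2).
  by apply: at_least_persists; rewrite realifyK.
move=> [[A B] [/= nA nB] AB]; apply: filterS nA => Q AQ ipQ.
have [y By cy] := general_dense (EDdegree_general ipQ) nB.
have /at_least_critical[s' [us' <- su']] := AB (Q, y) (conj AQ By).
have : [set` s'] #<= critical_points Q X (cplx y).
  by apply: subset_card_le => w /su'.
rewrite (card_le_eqr cy) (card_le_eql (card_uniq_seq us')) card_le_II.
by [].
Qed.

End Atlas.

End Semicontinuity.

Theorem theorem3p12 (R : realType) (k : nat) (n d : 'I_k -> nat)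
    (k_gt0 : (0 < k)%N) (d_gt0 : forall i, (0 < d i)%N)
    (QF : 'M[R]_(dimSd n d)) (QF_Frobenius : Frobenius_inner_product n d QF) :
  \forall Q \near QF, inner_product Q ->
    (EDdegree QF (segre_veronese R n d) <= EDdegree Q (segre_veronese R n d))%N.
Proof.
have [ipF _] := QF_Frobenius.
pose q0 : {dffun forall i : 'I_k, 'I_(n i).+1} := [ffun i => ord0].
exact: (EDdegree_lower_semicontinuous q0 (sv_charts_cover d_gt0) ipF).
Qed.
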